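(* Let $n = p_1^{a_1}\cdots p_r^{a_r}$ be the prime factorization of a positive integer $n$ with $p_1 < \dots < p_r$. Every group of order $n$ is supersolvable if and only if both of the following hold: (1) for every $1 \le i \le r$, the set of distinct primes dividing $\gcd(n, \psi(p_i^{a_i}))$ equals the set of distinct primes dividing $\gcd(n, p_i - 1)$; (2) whenever $i \neq k$ are indices with $p_i \le a_k$, then (a) there is no index $j$ with $p_i \mid p_j - 1$ and $p_j \mid p_k - 1$, and (b) $a_i \le 2$, and if $a_i = 2$ then $p_i^2 \mid p_k - 1$.
   Context: $\psi$ is the multiplicative function with $\psi(p^k) = (p^k-1)(p^{k-1}-1)\cdots(p-1)$ for a prime power $p^k$. A group $G$ is supersolvable if there is a series $\{e\} = R_0 \le R_1 \le \dots \le R_m = G$ with every $R_i$ normal in $G$ and every quotient $R_{i+1}/R_i$ cyclic. *)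

(* Defs.v *)
From mathcomp Require Import all_boot all_fingroup all_solvable.
Set Implicit Arguments. Unset Strict Implicit. Unset Printing Implicit Defensive.
Local Open Scope group_scope.

Definition psi_pp (p k : nat) : nat := (\prod_(1 <= j < k.+1) (p ^ j - 1))%N.

Definition psi (n : nat) : nat := (\prod_(p <- primes n) psi_pp p (logn p n))%N.

Definition supersolvable (gT : finGroupType) (G : {set gT}) : Prop :=
  exists (m : nat) (R : nat -> {group gT}),
    [/\ R 0%N = 1%G :> {set gT}, R m = G :> {set gT},
        forall i, (i <= m)%N -> R i <| G,
        forall i, (i < m)%N -> R i \subset R i.+1
      & forall i, (i < m)%N -> cyclic (R i.+1 / R i)].

(* Main.v *)
Require Import Defs.
From mathcomp Require Import all_boot all_fingroup all_solvable.
From mathcomp Require Import all_algebra all_field all_character.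
Set Implicit Arguments. Unset Strict Implicit. Unset Printing Implicit Defensive.

(** Sufficiency.  Let [p] be the smallest prime divisor of [|G|].  By (1), no element of
    prime order [<> p] acts nontrivially on a [p]-subgroup, so a Sylow [p]-subgroup [P]
    controls its own fusion and the transfer [G -> P / P'] has a proper kernel; by induction
    [G] has a normal Sylow [q]-subgroup [Q] for its largest prime [q].  In a minimal
    counterexample [Q] is a minimal normal subgroup of order [q^d], [d > 1], with a
    complement [H] acting faithfully and irreducibly, all of whose proper subgroups are
    abelian of exponent dividing [q - 1].  If [H] is a [p]-group, counting lines gives
    [p %| d], so by (2)(b) [H] is abelian of order dividing [q - 1] and [d = 1].  Otherwise
    either [H] is abelian, with the same conclusion, or [H = R ><| <[y]>] for an [r]-group [R]
    and a [p]-element [y] with [p %| r - 1] and [r %| q - 1]; the [p] distinct conjugates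
    under [y] of a weight of [R] then give [p <= d], against (2)(a).

    Necessity.  If [V = F_q^d] and [K <= GL(V)] are such that [V ><| K] has order dividing
    [n], then a normal subgroup of prime order contained in [V] is a common eigenline of [K].
    No such line exists when [K] is generated by an element of order [q] in [GL_j(p)] with
    [j > 1] minimal such that [q %| p^j - 1]; by a cyclic permutation matrix together with
    [diag(z^(t^i))] or [diag(w^i)]; or by a [p]-th root of a scalar matrix that is not
    the [p]-th power of a scalar matrix. *)

(** * Sylow towers *)

Section SylowTower.

Local Open Scope group_scope.

(** Condition (1) read factor by factor, $\psi(p^a)$ being the product of the $p^j - 1$ with $1 \le
    j \le a$. *)
Definition multiplicative_order_condition (n : nat) : Prop :=
  forall p q j, p \in primes n -> q \in primes n ->
    (0 < j <= logn p n)%N -> q %| p ^ j - 1 -> q %| p - 1.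

(* [y] permutes the elements of [X] in orbits of [q]-power size. *)
Lemma pelt_action_order (gT : finGroupType) (p q : nat) (X : {group gT}) y :
    prime q -> p != q -> p.-group X -> q.-elt y ->
    y \in 'N(X) -> y \notin 'C(X) ->
  (0 < logn p #|X : 'C_X[y]|)%N /\ q %| p ^ logn p #|X : 'C_X[y]| - 1.
Proof.
move=> q_pr neq_pq pX q_y nXy ncXy.
have pI: p.-nat #|X : 'C_X[y]| by apply: pnat_dvd pX; apply: dvdn_indexg.
have defI : (p ^ logn p #|X : 'C_X[y]|)%N = #|X : 'C_X[y]|.
  by rewrite -p_part part_pnat_id.
split.
  rewrite lt0n; apply: contra ncXy => /eqP e; move: defI; rewrite e expn0.
  move/esym/eqP; rewrite indexg_eq1 => /subsetIP[_].
  by rewrite sub_cent1.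
(* Counting fixed points modulo $q$ gives $|C_X(y)| \equiv |X|$; the factor $|C_X(y)|$, prime to
   $q$, then cancels. *)
have := pgroup_fix_mod q_y (_ : [acts <[y]>, on X | 'J]).
rewrite astabsJ cycle_subG nXy => /(_ isT).
rewrite afixJ cent_cycle => /eqP.
rewrite eqn_mod_dvd ?subset_leq_card ?subsetIl //.
rewrite -(Lagrange (subsetIl X 'C[y])) -{2}[#|'C_X[y]|]muln1 -mulnBr defI.
rewrite Gauss_dvdr // prime_coprime //.
have pC: p.-group 'C_X[y] by apply: pgroupS pX; apply: subsetIl.
apply: contra neq_pq => qC.
by have := pgroupP pC q q_pr qC; rewrite inE eq_sym.
Qed.

(* By induction on the index of [D = S :&: P] in [P]: as 'N(D) / 'C(D) is a [p]-group,
   'C(D) permutes the Sylow [p]-subgroups of 'N(D) transitively. *)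
Lemma Sylow_conj_cent_meet (gT : finGroupType) (p : nat) (G : {group gT}) :
    (forall X : {group gT}, X \subset G -> p.-group X ->
       p.-nat #|'N_G(X) : 'C_G(X)|) ->
  forall S P : {group gT}, p.-Sylow(G) S -> p.-Sylow(G) P ->
  exists2 c, c \in 'C_G(S :&: P) & P :=: S :^ c.
Proof.
move=> autX S P.
move: {2}_.+1 (ltnSn (#|P| - #|S :&: P|)) => m.
elim: m S P => // m IHm S P ltm sylS sylP.
have [sSG pS _] := and3P sylS; have [sPG pP _] := and3P sylP.
have oSP: #|S| = #|P| by rewrite (card_Hall sylS) (card_Hall sylP).
have [sPS | nsPS] := boolP (P \subset S).
  exists 1; rewrite ?group1 // conjsg1.
  by apply/eqP; rewrite eqEcard sPS oSP leqnn.
set D := (S :&: P)%G; have [sDS sDP] : D \subset S /\ D \subset P.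
  by rewrite subsetIl subsetIr.
have prDP : D \proper P.
  rewrite properE sDP; apply: contra nsPS => sPD.
  by apply: subset_trans sPD sDS.
have prDS : D \proper S.
  by rewrite properEcard sDS oSP proper_card.
have pD: p.-group D by apply: pgroupS pS.
have sDG: D \subset G by apply: subset_trans sSG.
have prN (T : {group gT}) : p.-group T -> D \proper T -> D \proper 'N_T(D).
  by move=> pT; apply: nilpotent_proper_norm (pgroup_nil pT).
set N := ('N_G(D))%G; set C := ('C_G(D))%G.
have nCN : C <| N by apply: subcent_normal.
have pNC : p.-nat #|N : C| := autX D sDG pD.
have pS1 : p.-group 'N_S(D) by apply: pgroupS pS; apply: subsetIl.
have pP1 : p.-group 'N_P(D) by apply: pgroupS pP; apply: subsetIl.
have [A sylA sSA] := Sylow_superset (setSI 'N(D) sSG : 'N_S(D) \subset N) pS1.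
have [B sylB sPB] := Sylow_superset (setSI 'N(D) sPG : 'N_P(D) \subset N) pP1.
have [x Nx defB] := Sylow_trans sylA sylB.
have sAN := pHall_sub sylA; have pA := pHall_pgroup sylA.
(* The index of $AC$ in $N$ divides both $|N : C|$, a power of $p$, and $|N : A|$, which is prime to
   $p$. *)
have defN : A * C = N.
  have nCA: A \subset 'N(C) by apply: subset_trans sAN (normal_norm nCN).
  rewrite -norm_joinEl //; apply/eqP; rewrite eqEsubset join_subG sAN normal_sub //=.
  rewrite -indexg_eq1; apply/eqP/(@pnat_1 p).
    by apply: pnat_dvd pNC; apply: indexgS; apply: joing_subr.
  apply: (@pnat_dvd _ #|N : A|); first by apply: indexgS; apply: joing_subl.
  by case/and3P: sylA.
have [c Cc defBc] : exists2 c, c \in C & B :=: A :^ c.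
  move: Nx; rewrite -defN => /mulsgP[a c Aa Cc defx].
  by exists c; rewrite // defB defx conjsgM conjGid.
have [sNP sNS] : 'N_P(D) \subset B /\ 'N_S(D) \subset A by [].
have pU (U : {group gT}) : p.-group U -> U \subset N ->
    exists2 V : {group gT}, p.-Sylow(G) V & U \subset V.
  move=> pU sUN; have sUG := subset_trans sUN (subsetIl _ _).
  by have [V sylV sUV] := Sylow_superset sUG pU; exists V.
have [U sylU sAU] := pU A pA sAN.
have oU : #|U| = #|P| by rewrite (card_Hall sylU) (card_Hall sylP).
(* $N_T(D)$ is larger than $D$, so [T] and [V] meet in more than [D] and the induction hypothesis
   applies. *)
have step (T V : {group gT}) : p.-Sylow(G) T -> p.-Sylow(G) V ->
    D \proper T -> 'N_T(D) \subset V ->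
    exists2 c, c \in 'C_G(D) & V :=: T :^ c.
  move=> sylT sylV prDT sNV.
  have sNTV: 'N_T(D) \subset T :&: V by rewrite subsetI subsetIl.
  have ltD: (#|D| < #|T :&: V|)%N.
    by apply: leq_trans (subset_leq_card sNTV); apply/proper_card/prN; case/and3P: sylT.
  have oV : #|V| = #|P| by rewrite (card_Hall sylV) (card_Hall sylP).
  have [|e Ce ->] := IHm T V _ sylT sylV.
    rewrite oV; rewrite ltnS in ltm; apply: leq_trans ltm.
    by rewrite ltn_sub2l // proper_card.
  exists e => //; apply: subsetP Ce; rewrite setIS // centS //.
  by apply: subset_trans sNTV; rewrite subsetI normG (proper_sub prDT).
have [x1 Cx1 defU] := step S U sylS sylU prDS (subset_trans sNS sAU).
have sylUc : p.-Sylow(G) (U :^ c)%G by rewrite pHallJ // (subsetP (subsetIl _ _) _ Cc).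
have sPUc : 'N_P(D) \subset (U :^ c)%G.
  by rewrite (subset_trans sNP) //= defBc conjSg.
have [x2 Cx2 defUc] := step P (U :^ c)%G sylP sylUc prDP sPUc.
(* From [S] to [U], then to [U :^ c], then back to [P], each time by an element centralizing [D]. *)
exists (x1 * c * x2^-1); first by rewrite !groupM ?groupV.
by rewrite !conjsgM -defU -[U :^ c]/(gval (U :^ c)%G) defUc -conjsgM mulgV conjsg1.
Qed.

(** As $x^g$ lies in $P^g \cap P$, some $c$ centralizing $x^g$ conjugates $P^g$ to $P$. Then $gc \in
    N_G(P) = C_G(P) P$, and its component in $P$ acts on $x$ as $g$ does. *)
Lemma Sylow_control_fusion (gT : finGroupType) (p : nat) (G P : {group gT}) :
    (forall X : {group gT}, X \subset G -> p.-group X ->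
       p.-nat #|'N_G(X) : 'C_G(X)|) ->
    p.-Sylow(G) P ->
  forall x g, x \in P -> g \in G -> x ^ g \in P ->
  exists2 u, u \in P & x ^ g = x ^ u.
Proof.
move=> autX sylP x g Px Gg Pxg.
have [sPG pP _] := and3P sylP.
have sylPg : p.-Sylow(G) (P :^ g)%G by rewrite pHallJ.
have [c] := Sylow_conj_cent_meet autX sylPg sylP.
case/setIP=> Gc cPc /= defP.
have cxg : commute (x ^ g) c.
  by apply/commute_sym/(centP cPc); rewrite inE Pxg memJ_conjg Px.
have nPgc : g * c \in 'N_G(P).
  by rewrite !inE groupM //= conjsgM -defP.
have := autX P sPG pP.
set N := 'N_G(P)%G; set C := 'C_G(P)%G => pNC.
have nCN : C <| N by apply: subcent_normal.
have sPN : P \subset N by rewrite subsetI sPG normG.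
have defN : C * P = N.
  rewrite -norm_joinEr ?(subset_trans sPN (normal_norm nCN)) //.
  apply/eqP; rewrite eqEsubset join_subG sPN normal_sub //=.
  rewrite -indexg_eq1; apply/eqP/(@pnat_1 p).
    by apply: pnat_dvd pNC; apply: indexgS; apply: joing_subl.
  apply: (@pnat_dvd _ #|N : P|); first by apply: indexgS; apply: joing_subr.
  apply: (@pnat_dvd _ #|G : P|); last by case/and3P: sylP.
  by rewrite indexSg ?subsetIl.
move: nPgc; rewrite -[_ \in _]/(g * c \in N) -defN => /mulsgP[k u /setIP[_ cPk] Pu def_gc].
exists u => //.
have -> : x ^ g = x ^ (g * c) by rewrite conjgM (conjgE (x ^ g)) cxg mulKg.
rewrite def_gc conjgM; congr (_ ^ _).
by rewrite conjgE -(centP cPk x Px) mulKg.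
Qed.

(* The kernel of the transfer G -> P / P'. *)
Lemma control_fusion_normal_proper (gT : finGroupType) (p : nat) (G P : {group gT}) :
    p.-Sylow(G) P -> P :!=: 1 ->
    (forall x g, x \in P -> g \in G -> x ^ g \in P ->
       exists2 u, u \in P & x ^ g = x ^ u) ->
  exists K : {group gT}, [/\ K <| G, K \proper G & p.-group (G / K)].
Proof.
move=> sylP ntP fusP; have [sPG pP p'i] := and3P sylP.
have p_pr : prime p.
  by have [] := pgroup_pdiv pP ntP.
have nP'P := der_norm 1 P.
set alpha := [morphism of restrm nP'P (coset P^`(1))].
have abA : abelian (alpha @* P).
  by rewrite morphim_restrm setIid sub_der1_abelian.
pose tau := transfer_morphism G abA.
have pA : p.-group (alpha @* P) by apply: morphim_pgroup.
exists ('ker tau)%G; split; first exact: ker_normal.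
  rewrite properE normal_sub ?ker_normal //=.
  have prP' : P^`(1) \proper P by rewrite (sol_der1_proper (pgroup_sol pP)).
  have [_ [x Px nP'x]] := properP prP'.
  have Gx := subsetP sPG x Px.
  apply: contra nP'x => /subsetP/(_ x Gx)/mker /=.
  have trX := transversalP (rcosets_cycle_partition sPG Gx).
  rewrite (transfer_cycle_expansion sPG abA Gx trX).
  (* Control of fusion turns each factor of the transfer into a power of [alpha x]; the total
     exponent is $|G : P|$, prime to $p$, so a trivial transfer forces [alpha x] to be trivial. *)
  rewrite (eq_bigr (fun y => (FiniteModule.fmod abA (alpha x) *+ #|<[x]> : P :* y|)%R)).
    rewrite GRing.sumrMnr (sum_index_rcosets_cycle sPG Gx trX) => /(congr1 val).
    rewrite FiniteModule.fmvalZ FiniteModule.fmval0.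
    rewrite FiniteModule.fmodK ?mem_morphim // => /eqP.
    rewrite -order_dvdn => ox.
    have /eqP : #[alpha x] = 1%N.
      apply: (@pnat_1 p); last exact: pnat_dvd ox p'i.
      by apply: (mem_p_elt pA); rewrite mem_morphim.
    by rewrite order_eq1 => /eqP /coset_idr; apply; apply: (subsetP nP'P).
  move=> y Xy; set n := #|_ : _|.
  have Gy : y \in G by apply: (subsetP (transversal_sub trX)).
  have Pxny : (x ^+ n) ^ y^-1 \in P.
    have := mulg_exp_card_rcosets P x y; rewrite -/n mem_rcoset.
    by rewrite conjgE invgK mulgA.
  have [u Pu ->] := fusP _ _ (groupX n Px) (groupVr Gy) Pxny.
  have aP z : z \in P -> alpha z \in alpha @* P by move=> Pz; rewrite mem_morphim.
  rewrite -FiniteModule.fmodX ?aP //= /restrm /=; congr (FiniteModule.fmod _ _).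
  rewrite -[coset _ _]/(alpha (x ^+ n ^ u)) -[coset _ x]/(alpha x).
  rewrite morphJ ?groupX // morphX // conjgE.
  by rewrite ((centsP abA) (alpha x ^+ n) _ (alpha u)) ?groupX ?aP // mulKg.
rewrite (isog_pgroup p (first_isog tau)).
apply: pgroupS (morphim_pgroup (FiniteModule.fmod_morphism abA) pA).
apply/subsetP=> _ /morphimP[x Gx _ ->].
rewrite -[tau x]FiniteModule.fmvalK.
have ? : FiniteModule.fmval (tau x) \in alpha @* P by apply: FiniteModule.fmodP.
exact: mem_morphim.
Qed.

Section OrderCondition.

Variable n : nat.
Hypotheses (n_gt0 : (0 < n)%N) (condn : multiplicative_order_condition n).

Lemma order_condition_pelt (gT : finGroupType) (p q : nat) (X : {group gT}) y :
    p \in primes n -> q \in primes n -> p != q -> p.-group X -> q.-elt y ->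
    #|X| %| n -> y \in 'N(X) -> y \notin 'C(X) ->
  q %| p - 1.
Proof.
move=> p_n q_n neq_pq pX q_y X_n nXy ncXy.
have q_pr : prime q by move: q_n; rewrite mem_primes => /and3P[].
have [k_gt0 q_k] := pelt_action_order q_pr neq_pq pX q_y nXy ncXy.
apply: condn p_n q_n _ q_k; rewrite k_gt0 /=.
by apply: dvdn_leq_log => //; apply: dvdn_trans X_n; apply: dvdn_indexg.
Qed.

(** A prime $r \ne p$ dividing the index yields an $r$-element acting nontrivially on [X], so $r
    \mid p - 1$ by (1), although $p$ is the least prime divisor of $|G|$. *)
Lemma pdiv_automizer_pgroup (gT : finGroupType) (G X : {group gT}) :
    #|G| %| n -> X \subset G -> (pdiv #|G|).-group X ->
  (pdiv #|G|).-nat #|'N_G(X) : 'C_G(X)|.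
Proof.
set p := pdiv _ => Gn sXG pX.
apply/pnatP=> // r r_pr r_idx; rewrite !inE; apply: contraT => neq_rp.
have G_gt1 : (1 < #|G|)%N.
  rewrite cardG_gt1; apply: contraL r_idx => /eqP G1.
  have -> : 'N_G(X) = 'C_G(X).
    apply/eqP; rewrite eqEsubset andbC setIS ?cent_sub //= subsetI subsetIl /=.
    by apply: subset_trans (subsetIl _ _) _; rewrite G1 sub1G.
  by rewrite indexgg dvdn1 neq_ltn prime_gt1 ?orbT.
have p_n : p \in primes n.
  by rewrite mem_primes pdiv_prime // n_gt0 (dvdn_trans (pdiv_dvd _)).
have r_G : r %| #|G|.
  apply: dvdn_trans r_idx (dvdn_trans (dvdn_indexg _ _) _).
  by rewrite cardSg ?subsetIl.
have r_n : r \in primes n by rewrite mem_primes r_pr n_gt0 (dvdn_trans r_G).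
have [R sylR] := Sylow_exists r 'N_G(X); have [sRN rR r'N] := and3P sylR.
have [cRX | /subsetPn[y Ry ncXy]] := boolP (R \subset 'C(X)).
  have sRC : R \subset 'C_G(X).
    by rewrite subsetI cRX (subset_trans sRN) ?subsetIl.
  move: r'N; rewrite -(Lagrange_index (_ : 'C_G(X) \subset 'N_G(X)) sRC).
    by rewrite pnatM => /andP[/(pnat_dvd r_idx)]; rewrite pnatE // !inE eqxx.
  by rewrite setIS ?cent_sub.
have /setIP[_ nXy] := subsetP sRN y Ry.
have := order_condition_pelt p_n r_n _ pX (mem_p_elt rR Ry) _ nXy ncXy.
rewrite eq_sym neq_rp (dvdn_trans (cardSg sXG) Gn) => /(_ isT isT) r_p.
have p_gt1 : (1 < p)%N by rewrite prime_gt1 ?pdiv_prime.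
have /(dvdn_leq _) := r_p; rewrite subn_gt0 p_gt1 => /(_ isT) le_rp.
have := pdiv_min_dvd (prime_gt1 r_pr) r_G; rewrite -/p leqNgt => /negP[].
by apply: leq_ltn_trans le_rp _; rewrite ltn_subrL (ltnW p_gt1).
Qed.

(** Unless [G] is a $q$-group, the transfer gives a proper normal [K] with $G/K$ a $p$-group, $p \ne
    q$. By induction the Sylow $q$-subgroup of [K] is normal, hence characteristic in [K], and it is
    also Sylow in [G]. *)
Lemma max_prime_Sylow_normal (gT : finGroupType) (G Q : {group gT}) :
  #|G| %| n -> (max_pdiv #|G|).-Sylow(G) Q -> Q <| G.
Proof.
move: {2}_.+1 (ltnSn #|G|) => m; elim: m => // m IHm in G Q *.
rewrite ltnS => leGm Gn.
set q := max_pdiv _ => sylQ; have [sQG qQ q'G] := and3P sylQ.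
have [G_le1 | G_gt1] := leqP #|G| 1.
  by move: sQG; rewrite (card_le1_trivg G_le1) => /trivgP->.
set p := pdiv #|G|.
have p_pr : prime p by rewrite pdiv_prime.
have q_pr : prime q by rewrite max_pdiv_prime.
have [eq_pq | neq_pq] := eqVneq p q.
  suff qG : q.-group G.
    rewrite (_ : Q :=: G) ?normal_refl //.
    by apply/eqP; rewrite eqEcard sQG (card_Hall sylQ) part_pnat_id ?leqnn.
  apply/pnatP=> // r r_pr r_G; rewrite inE eqn_leq max_pdiv_max ?mem_primes ?r_pr ?cardG_gt0 //.
  by rewrite -eq_pq pdiv_min_dvd // prime_gt1.
have [P sylP] := Sylow_exists p G.
have ntP : P :!=: 1.
  by rewrite -cardG_gt1 (card_Hall sylP) p_part_gt1 mem_primes p_pr cardG_gt0 pdiv_dvd.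
have autX (X : {group gT}) : X \subset G -> p.-group X -> p.-nat #|'N_G(X) : 'C_G(X)|.
  exact: pdiv_automizer_pgroup.
have [K [nKG prK pGK]] := control_fusion_normal_proper sylP ntP (Sylow_control_fusion autX sylP).
have sKG := normal_sub nKG.
have q'i : q^'.-nat #|G : K|.
  rewrite -card_quotient ?normal_norm //; apply: sub_in_pnat pGK => r _.
  by rewrite !inE => /eqP->.
have q_dvd_G : q %| #|G| by rewrite max_pdiv_dvd.
have q_K : q %| #|K|.
  move: q_dvd_G; rewrite -(Lagrange sKG) Euclid_dvdM // => /orP[] // q_i.
  by move: (pnat_dvd q_i q'i); rewrite pnatE // !inE eqxx.
have maxK : max_pdiv #|K| = q.
  have K_gt1 : (1 < #|K|)%N by apply: leq_trans (prime_gt1 q_pr) (dvdn_leq _ q_K).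
  apply/eqP; rewrite eqn_leq [(q <= _)%N]max_pdiv_max ?mem_primes ?q_pr ?cardG_gt0 // andbT.
  rewrite max_pdiv_max // mem_primes max_pdiv_prime // cardG_gt0.
  by rewrite (dvdn_trans (max_pdiv_dvd _)) ?cardSg.
have [S sylS] := Sylow_exists q K.
have nSK : S <| K.
  apply: IHm; rewrite ?maxK //; last exact: dvdn_trans (cardSg sKG) Gn.
  by apply: leq_trans leGm; apply: proper_card.
have nSG : S <| G.
  by rewrite -(normal_Hall_pcore sylS nSK) gFnormal_trans.
have sylSG : q.-Sylow(G) S.
  rewrite pHallE (subset_trans (normal_sub nSK)) //= (card_Hall sylS).
  by rewrite -(Lagrange sKG) partnM ?cardG_gt0 ?indexg_gt0 // [(#|G : K|`_q)%N]part_p'nat // muln1.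
by rewrite (eq_Hall_pcore _ sylQ) ?pcore_normal // (normal_Hall_pcore sylSG).
Qed.

End OrderCondition.

End SylowTower.

(** * Supersolvable groups *)

Section Supersolvable.

Local Open Scope group_scope.

Lemma cyclic_section_meet (gT : finGroupType) (A B N : {group gT}) :
  B <| A -> cyclic (A / B) -> cyclic ((A :&: N) / (B :&: N)).
Proof.
move=> nBA cycAB.
have nBAN : A :&: N \subset 'N(B) by rewrite (subset_trans (subsetIl _ _)) ?normal_norm.
have <- : B :&: (A :&: N) = B :&: N by rewrite setIA (setIidPl (normal_sub nBA)).
rewrite (isog_cyclic (second_isog nBAN)).
by apply: cyclicS cycAB; rewrite quotientS ?subsetIl.
Qed.

(** At the first index where [T i] meets [N] nontrivially, the intersection embeds in a cyclic
    factor, so its subgroup of prime order is characteristic in it. Asking only $T_0 \cap N = 1$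
    allows a series starting above 1. *)
Lemma cyclic_series_prime_normal (gT : finGroupType) (G N : {group gT}) m
    (T : nat -> {group gT}) :
    N <| G -> N :!=: 1 -> T 0%N :&: N = 1 -> N \subset T m ->
    (forall i, (i <= m)%N -> T i <| G) ->
    (forall i, (i < m)%N -> T i \subset T i.+1) ->
    (forall i, (i < m)%N -> cyclic (T i.+1 / T i)) ->
  exists L : {group gT}, [/\ L <| G, L \subset N & prime #|L|].
Proof.
move=> nNG ntN T0 sNT nT sT cycT.
have ex_i : exists i, T i :&: N != 1 by exists m; rewrite (setIidPr sNT).
have le_im i : T i :&: N != 1 -> (forall j, T j :&: N != 1 -> (i <= j)%N) -> (i <= m)%N.
  by move=> _; apply; rewrite (setIidPr sNT).
case: (ex_minnP ex_i) => [[|i]]; first by rewrite T0 eqxx.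
move=> ntTi min_i; have im := le_im _ ntTi min_i.
have Ti1 : T i :&: N = 1.
  by apply/eqP; apply: contraT => /min_i; rewrite ltnn.
have cycC : cyclic (T i.+1 :&: N).
  have nTi : T i <| T i.+1.
    by rewrite /normal sT // (subset_trans (normal_sub (nT _ im))) ?normal_norm ?nT // ltnW.
  have := cyclic_section_meet N nTi (cycT i im).
  by rewrite Ti1 -(isog_cyclic (quotient1_isog _)).
have p_pr : prime (pdiv #|T i.+1 :&: N|) by rewrite pdiv_prime // cardG_gt1.
have [x Cx ox] := Cauchy p_pr (pdiv_dvd _).
exists <[x]>%G; split; last by rewrite -orderE ox.
  apply: char_normal_trans (_ : T i.+1 :&: N <| G); last by rewrite normalI ?nT.
  by rewrite sub_cyclic_char // cycle_subG.
by rewrite cycle_subG (subsetP _ _ Cx) ?subsetIr.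
Qed.

Lemma supersolvable_prime_normal (gT : finGroupType) (G N : {group gT}) :
    supersolvable G -> N <| G -> N :!=: 1 ->
  exists L : {group gT}, [/\ L <| G, L \subset N & prime #|L|].
Proof.
case=> m [R [R0 Rm nR sR cycR]] nNG ntN.
apply: (cyclic_series_prime_normal nNG ntN _ _ nR sR cycR).
  by rewrite R0 (setIidPl (sub1G _)).
by rewrite Rm normal_sub.
Qed.

Lemma cosetpre_section_cyclic (gT : finGroupType) (K : {group gT})
    (A B : {group coset_of K}) :
  B <| A -> cyclic (A / B) -> cyclic (coset K @*^-1 A / coset K @*^-1 B).
Proof.
move=> nBA cycAB; set A1 := (coset K @*^-1 A)%G; set B1 := (coset K @*^-1 B)%G.
have defA : A = (A1 / K)%G by apply/val_inj; rewrite /= cosetpreK.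
have defB : B = (B1 / K)%G by apply/val_inj; rewrite /= cosetpreK.
rewrite -[coset K @*^-1 A]/(gval A1) -[coset K @*^-1 B]/(gval B1).
have sK (D : {group coset_of K}) : K \subset coset K @*^-1 D by rewrite -{1}ker_coset morphpreS ?sub1G.
have nK : K <| A1 by rewrite /normal sK subsetIl.
have nB : B1 <| A1 by rewrite cosetpre_normal.
rewrite -(isog_cyclic (third_isog (sK B) nK nB)).
by have: cyclic ((A1 / K)%G / (B1 / K)%G) by rewrite -defA -defB.
Qed.

(** The preimages in [G] of a series of $G/K$ start at [K], which meets [N] trivially. *)
Lemma quotient_supersolvable_prime_normal (gT : finGroupType) (G K N : {group gT}) :
    K <| G -> supersolvable (G / K) -> N <| G -> N :!=: 1 -> K :&: N = 1 ->
  exists L : {group gT}, [/\ L <| G, L \subset N & prime #|L|].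
Proof.
move=> nKG [m [R [R0 Rm nR sR cycR]]] nNG ntN tiKN.
pose T i := (coset K @*^-1 R i)%G.
have nRS i : (i < m)%N -> R i <| R i.+1.
  move=> im; rewrite /normal sR // (subset_trans (normal_sub (nR _ im))) //.
  by rewrite normal_norm // nR // ltnW.
apply: (@cyclic_series_prime_normal _ G N m T) => //=.
- by rewrite R0 -kerE ker_coset.
- by rewrite Rm quotientGK // normal_sub.
- by move=> i im; rewrite -(quotientGK nKG) cosetpre_normal nR.
- by move=> i im; rewrite morphpreS ?sR.
by move=> i im; rewrite cosetpre_section_cyclic ?cycR ?nRS.
Qed.

Lemma supersolvable_ext (gT : finGroupType) (G L : {group gT}) :
  L <| G -> cyclic L -> supersolvable (G / L) -> supersolvable G.
Proof.
move=> nLG cycL [m [R [R0 Rm nR sR cycR]]].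
exists m.+1, (fun i => if i is j.+1 then (coset L @*^-1 R j)%G else 1%G).
have nRS i : (i < m)%N -> R i <| R i.+1.
  move=> im; rewrite /normal sR // (subset_trans (normal_sub (nR _ im))) //.
  by rewrite normal_norm // nR // ltnW.
split=> //=.
- by rewrite Rm quotientGK.
- by case=> [|i] im; rewrite ?normal1 //= -(quotientGK nLG) cosetpre_normal nR.
- by case=> [|i] im; rewrite ?sub1G // morphpreS ?sR.
case=> [|i] im /=; last by rewrite cosetpre_section_cyclic ?cycR ?nRS.
by rewrite R0 -kerE ker_coset -(isog_cyclic (quotient1_isog _)).
Qed.

Lemma supersolvable1 (gT : finGroupType) : supersolvable [1 gT].
Proof. by exists 0%N, (fun=> 1%G); split=> // i _; rewrite normal1. Qed.

(** By induction $a = [b, x]$ is fixed by $x$, so $b^{x^k} = b a^k$; the order of $a$ then divides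
    both that of $x$ and $|N|$, and $a = 1$. *)
Lemma coprime_stable_series_cent (gT : finGroupType) (N : {group gT}) x m
    (T : nat -> {group gT}) :
    coprime #|N| #[x] -> T 0%N :&: N = 1 -> N \subset T m ->
    (forall i b, (i < m)%N -> b \in T i.+1 :&: N -> [~ b, x] \in T i :&: N) ->
  x \in 'C(N).
Proof.
move=> coNx T0 sNTm actx.
suff cx i : (i <= m)%N -> T i :&: N \subset 'C[x].
  by rewrite -sub_cent1 -(setIidPr sNTm) cx.
elim: i => [|i IHi] im; first by rewrite T0 sub1G.
apply/subsetP=> b Tb; apply/cent1P.
have Ta := actx i b im Tb; set a := [~ b, x] in Ta.
have cax : commute a x by apply/cent1P; apply: (subsetP (IHi (ltnW im))).
have bxk k : b ^ (x ^+ k) = b * a ^+ k.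
  elim: k => [|k IHk]; first by rewrite conjg1 mulg1.
  rewrite expgSr conjgM IHk conjMg conjXg (conjgE a) cax mulKg.
  by rewrite conjg_mulR -mulgA -expgS.
have ak : a ^+ #[x] = 1.
  by apply: (mulgI b); rewrite -bxk expg_order conjg1 mulg1.
have Na : a \in N by case/setIP: Ta.
have a1 : a = 1.
  apply/eqP; rewrite -order_eq1 -dvdn1 -(eqP coNx) dvdn_gcd order_dvdG //=.
  by rewrite order_dvdn ak.
by apply/commgP; rewrite -/a a1.
Qed.

(** $N(A)/C(A)$ embeds in the automorphism group of a cyclic group of order 1 or $q$, which is
    abelian of order dividing $q - 1$. *)
Lemma cyclic_abelem_norm_cent (gT : finGroupType) (q : nat) (A : {group gT}) :
    q.-abelem A -> cyclic A ->
  {in 'N(A) &, forall g h, [~ g, h] \in 'C(A)}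
    /\ {in 'N(A), forall g, g ^+ q.-1 \in 'C(A)}.
Proof.
move=> abA cycA; have abAut := Aut_cyclic_abelian cycA.
have mem_Aut g : g \in 'N(A) -> conj_aut A g \in Aut A by move=> nAg; apply: (subsetP (Aut_conj_aut A setT)); rewrite mem_morphim.
split=> [g h nAg nAh | g nAg]; rewrite -ker_conj_aut; apply/kerP; rewrite ?groupX ?groupR //.
  by rewrite morphR //; apply/eqP/commgP/(centsP abAut); rewrite mem_Aut.
rewrite morphX //; apply/eqP; rewrite -order_dvdn.
apply: dvdn_trans (order_dvdG (mem_Aut g nAg)) _; rewrite card_Aut_cyclic //.
have [-> | ntA] := eqsVneq A 1; first by rewrite cards1 dvd1n.
have [q_pr _ _] := pgroup_pdiv (abelem_pgroup abA) ntA.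
by rewrite (cyclic_abelem_prime abA cycA ntA) totient_prime.
Qed.

(** Commutators and $(q-1)$-th powers in [M] act trivially on each factor of the series cut with
    [N], as these are cyclic and elementary abelian. By coprimality they centralize [N], hence are
    trivial. *)
Lemma supersolvable_coprime_factor (gT : finGroupType) (q : nat) (X M N : {group gT}) :
    supersolvable X -> N <| X -> M \subset X -> q.-abelem N ->
    coprime #|N| #|M| -> 'C_M(N) = 1 ->
  abelian M /\ {in M, forall x, x ^+ q.-1 = 1}.
Proof.
case=> m [R [R0 Rm nR sR cycR]] nNX sMX abN coNM cMN1.
pose stab x := forall i b, (i < m)%N -> b \in R i.+1 :&: N -> [~ b, x] \in R i :&: N.
have stab1 x : x \in M -> stab x -> x = 1.
  move=> Mx stx; apply/set1P; rewrite -set1gE -cMN1 inE Mx /=.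
  apply: (coprime_stable_series_cent _ _ _ stx).
  - by rewrite (coprime_dvdr (order_dvdG Mx)).
  - by rewrite R0 (setIidPl (sub1G _)).
  by rewrite Rm normal_sub.
have stabP x : x \in X -> (forall i, (i < m)%N ->
    coset (R i :&: N) x \in 'C((R i.+1 :&: N) / (R i :&: N))) -> stab x.
  move=> Xx cx i b im Ab.
  have nB : X \subset 'N(R i :&: N) by rewrite normal_norm // normalI ?nR // ltnW.
  have Xb : b \in X by apply: subsetP Ab; rewrite subIset // (normal_sub nNX) orbT.
  have nBb := subsetP nB b Xb; have nBx := subsetP nB x Xx.
  apply: coset_idr; first by rewrite groupR.
  rewrite morphR //; apply/eqP/commgP/commute_sym.
  by apply: (centP (cx i im)); rewrite mem_morphim.
have sect i : (i < m)%N ->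
    [/\ X \subset 'N(R i :&: N), X / (R i :&: N) \subset 'N((R i.+1 :&: N) / (R i :&: N)),
        q.-abelem ((R i.+1 :&: N) / (R i :&: N)) & cyclic ((R i.+1 :&: N) / (R i :&: N))].
  move=> im; have nB : R i :&: N <| X by rewrite normalI ?nR // ltnW.
  split; first exact: normal_norm.
  - by rewrite quotient_norms // normal_norm // normalI ?nR.
  - by rewrite quotient_abelem // (abelemS _ abN) ?subsetIr.
  apply: cyclic_section_meet; last exact: cycR.
  by rewrite (normalS _ (normal_sub (nR _ im)) (nR _ (ltnW im))) ?sR.
split=> [|x Mx].
  apply/centsP=> g Mg h Mh; apply/commgP/eqP; apply: stab1; first by rewrite groupR.
  have [Xg Xh] := (subsetP sMX g Mg, subsetP sMX h Mh).
  apply: stabP => [|i im]; first by rewrite groupR.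
  have [nB nA abA cycA] := sect i im.
  rewrite morphR ?(subsetP nB) //.
  by apply: (cyclic_abelem_norm_cent abA cycA).1; rewrite (subsetP nA) ?mem_quotient.
apply: stab1; first by rewrite groupX.
have Xx := subsetP sMX x Mx.
apply: stabP => [|i im]; first by rewrite groupX.
have [nB nA abA cycA] := sect i im.
rewrite morphX ?(subsetP nB) //.
by apply: (cyclic_abelem_norm_cent abA cycA).2; rewrite (subsetP nA) ?mem_quotient.
Qed.

(** The nontrivial elements of [N] are sorted by the subgroup they generate; each of these has $q -
    1$ generators. *)
Lemma card_prime_subgroups (gT : finGroupType) (q : nat) (N : {group gT}) :
    q.-abelem N ->
  (#|[set L : {group gT} | (L \subset N) && (#|L| == q)]| * q.-1)%N = #|N|.-1.
Proof.
move=> abN; set S := [set L : {group gT} | _].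
have [N1 | ntN] := eqsVneq N 1.
  (* [q] need not be prime when [N] is trivial; for $q = 1$ the factor [q.-1] vanishes. *)
  rewrite N1 cards1; have [-> | q_neq1] := eqVneq q 1%N; first by rewrite muln0.
  rewrite (_ : S = set0) ?cards0 //; apply/setP=> L; rewrite !inE.
  by apply/andP=> -[]; rewrite N1 => sL1; rewrite (trivgP sL1) cards1 eq_sym (negPf q_neq1).
have [q_pr _ _] := pgroup_pdiv (abelem_pgroup abN) ntN.
have oN x : x \in N^# -> #[x] = q.
  by case/setD1P=> ntx Nx; apply: abelem_order_p abN Nx ntx.
have -> : #|N|.-1 = #|N^#| by rewrite [#|N|](cardsD1 1) group1.
rewrite -[RHS]sum1_card (partition_big (fun x => <[x]>%G) (mem S)) /=; last first.
  by move=> x Nx; rewrite inE /= -orderE oN // eqxx cycle_subG; case/setD1P: Nx => _ ->.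
rewrite -sum_nat_const; apply: eq_bigr => L; rewrite inE => /andP[sLN /eqP oL].
have [|x Lx ox] := @Cauchy _ q L q_pr; first by rewrite oL.
have defL : L :=: <[x]> by apply/eqP; rewrite eq_sym eqEcard cycle_subG Lx -orderE ox oL leqnn.
rewrite sum1dep_card -(totient_prime q_pr) -{1}ox totient_gen.
apply: eq_card => z; rewrite !inE /generator -defL.
rewrite -[_%G == L](inj_eq val_inj) /= [<[z]> == L]eq_sym andbC; case: eqP => //= defz.
have Lz : z \in L by rewrite defz cycle_id.
rewrite (subsetP sLN) // andbT; symmetry; apply: contraTneq (prime_gt1 q_pr) => z1.
by rewrite -oL defz z1 cycle1 cards1.
Qed.

(* The number of lines is (q^d - 1) / (q - 1) = d modulo p. *)
Lemma pgroup_invariant_line (gT : finGroupType) (p q : nat) (P N : {group gT}) :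
    prime p -> p.-group P -> q.-abelem N -> P \subset 'N(N) -> N :!=: 1 ->
    p %| q.-1 -> ~~ (p %| logn q #|N|) ->
  exists L : {group gT}, [/\ L \subset N, #|L| = q & P \subset 'N(L)].
Proof.
move=> p_pr pP abN nNP ntN p_q p'd.
have [q_pr _ _] := pgroup_pdiv (abelem_pgroup abN) ntN.
set S := [set L : {group gT} | (L \subset N) && (#|L| == q)].
have actS : [acts P, on S | 'JG].
  apply/subsetP=> g Pg; rewrite !inE; apply/subsetP=> L; rewrite !inE /=.
  by rewrite cardJg -{2}(normsP nNP g Pg) conjSg.
have oS : #|S| = (\sum_(i < logn q #|N|) q ^ i)%N.
  have q1_gt0 : (0 < q.-1)%N by rewrite -subn1 subn_gt0 prime_gt1.
  apply/eqP; rewrite -(eqn_pmul2r q1_gt0) card_prime_subgroups //.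
  by rewrite [X in _ == X]mulnC -predn_exp -(card_pgroup (abelem_pgroup abN)).
have oSd : #|S| = logn q #|N| %[mod p].
  rewrite oS; elim: (logn _ _) => [|d IHd]; first by rewrite big_ord0.
  have q_p : q = 1 %[mod p] by apply/eqP; rewrite eqn_mod_dvd ?subn1 // prime_gt0.
  by rewrite big_ord_recr /= -modnDm IHd -modnXm q_p modnXm exp1n modnDm addn1.
have := pgroup_fix_mod pP actS; rewrite oSd => fixd.
have /set0Pn[L] : 'Fix_(S | 'JG)(P) != set0.
  apply: contra p'd => /eqP fix0.
  by rewrite /dvdn fixd fix0 cards0 mod0n.
case/setIP; rewrite inE => /andP[sLN /eqP oL] /afixP fixL; exists L; split=> //.
by apply/normsP=> g Pg; have /(congr1 val) := fixL g Pg.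
Qed.

End Supersolvable.

(** * Irreducible actions *)

Section Eigenvectors.

Local Open Scope group_scope.
Import GRing.Theory.
Local Open Scope ring_scope.

Lemma Fp_prim_root (q m : nat) :
  prime q -> (m %| q.-1)%N -> exists z : 'F_q, m.-primitive_root z.
Proof.
move=> q_pr m_q.
have q1_gt0 : (0 < q.-1)%N by rewrite -subn1 subn_gt0 prime_gt1.
have unit_root : all (q.-1).-unity_root (enum (predC1 (0 : 'F_q))).
  apply/allP=> x; rewrite mem_enum /= => nzx; apply/unity_rootP.
  apply: (mulfI nzx); rewrite -exprS prednK ?prime_gt0 // mulr1.
  by have := expf_card x; rewrite card_Fp.
have := has_prim_root q1_gt0 unit_root (enum_uniq _).
rewrite -cardE cardC1 card_Fp // leqnn => /(_ isT)/hasP[z _ prim_z].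
by exists (z ^+ (q.-1 %/ m)); apply: dvdn_prim_root.
Qed.

(** If $|H|$ divides $q - 1$, the field of $q$ elements contains the $|H|$-th roots of unity, so it
    splits [H] and irreducible modules have dimension 1. *)
Lemma abelian_irreducible_line (gT : finGroupType) (q : nat) (H N : {group gT}) :
    q.-abelem N -> minnormal N H -> 'C_H(N) = 1%g -> abelian H ->
  cyclic H /\ ((#|H| %| q.-1)%N -> prime #|N|).
Proof.
move=> abN minN cHN1 abH.
have [/andP[ntN nNH] _] := mingroupP minN.
have [q_pr _ _] := pgroup_pdiv (abelem_pgroup abN) ntN.
have /(abelem_mx_irrP abN ntN nNH) irrN := minN.
have faithN := abelem_mx_faithful abN ntN nNH cHN1.
split=> [|H_q]; first exact: mx_faithful_irr_abelian_cyclic faithN irrN abH.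
have [z prim_z] := Fp_prim_root q_pr H_q.
have splitH := primitive_root_splitting_abelian prim_z abH.
rewrite (card_pgroup (abelem_pgroup abN)) -(dim_abelemE abN ntN).
by rewrite (mx_irr_abelian_linear splitH irrN abH) expn1.
Qed.

(** In a linear relation with nonzero coefficients at $i \ne j$, choose [t] separating the two
    weights: applying [A t] and subtracting [c j t] times the relation removes the coefficient at
    $j$ but not the one at $i$. *)
Lemma eigenvectors_independent (F : fieldType) (d m : nat) (T : Type)
    (A : T -> 'M[F]_d) (V : 'I_m -> 'rV[F]_d) (c : 'I_m -> T -> F) :
    (forall i, V i != 0) -> (forall i t, V i *m A t = c i t *: V i) ->
    (forall i j, i != j -> exists t, c i t != c j t) ->
  (m <= d)%N.
Proof.
move=> nzV eigV neq_c; pose M := \matrix_i V i.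
suff freeM : row_free M by rewrite -(eqP freeM) rank_leq_col.
apply: inj_row_free => u.
move: {2}_.+1 (ltnSn #|[set i | u 0 i != 0]|) => k.
elim: k u => // k IHk u; rewrite ltnS => le_uk uM0.
apply/eqP; apply: contraT => /rV0Pn[i nz_ui].
have [j /andP[neq_ji nz_uj] | u_i] := pickP [pred j | (j != i) && (u 0 j != 0)]; last first.
  have: u *m M = u 0 i *: V i.
    rewrite mulmx_sum_row (bigD1 i) //= rowK big1 ?addr0 // => j neq_ji.
    by have := u_i j; rewrite /= neq_ji /= => /negbFE/eqP->; rewrite scale0r.
  by rewrite uM0 => /esym/eqP; rewrite scaler_eq0 (negPf nz_ui) (negPf (nzV i)).
have [t neq_t] := neq_c _ _ neq_ji.
pose w := \row_l (u 0 l * (c l t - c j t)).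
have wM0 : w *m M = 0.
  have -> : w *m M = u *m M *m A t - c j t *: (u *m M).
    rewrite [u *m M]mulmx_sum_row [w *m M]mulmx_sum_row mulmx_suml scaler_sumr -sumrB; apply: eq_bigr => l _.
    by rewrite !rowK -scalemxAl eigV mxE !scalerA -scalerBl [c j t * _]mulrC -mulrBr.
  by rewrite uM0 mul0mx scaler0 subr0.
have /rowP/(_ i) : w = 0.
  apply: IHk wM0; apply: leq_trans le_uk; apply: proper_card; apply/properP; split.
    by apply/subsetP=> l; rewrite !inE mxE mulf_eq0 negb_or => /andP[].
  by exists j; rewrite !inE ?nz_uj // mxE subrr mulr0 eqxx.
by rewrite !mxE => /eqP; rewrite mulf_eq0 (negPf nz_ui) subr_eq0 eq_sym (negPf neq_t).
Qed.

(* The weight of [v] has [p] distinct conjugates under [y]: were two of them equal, the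
   weight would be [H]-invariant and [R] would act on the irreducible module by scalars. *)
Lemma irreducible_dim_ge (F : fieldType) (d p : nat) (gT : finGroupType)
    (H R : {group gT}) (y : gT) (rH : mx_representation F H d) (v : 'rV[F]_d) :
    prime p -> mx_faithful rH -> mx_irreducible rH ->
    R \subset H -> y \in H -> y \in 'N(R)%g -> H \subset (R * <[y]>)%g ->
    abelian R -> (y ^+ p)%g \in 'C(R)%g -> y \notin 'C(R)%g ->
    v != 0 -> (forall x, x \in R -> exists a, v *m rH x = a *: v) ->
  (p <= d)%N.
Proof.
move=> p_pr faithH irrH sRH Hy nRy sHRy abR cyp ncy nzv eigv.
have /rV0Pn[i0 nz_vi0] := nzv.
(* The weight of [v], read off at a coordinate where [v] is nonzero; [f k] below is the weight of
   its translate by $y^k$. *)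
pose c x := (v *m rH x) 0 i0 / v 0 i0.
have vR x : x \in R -> v *m rH x = c x *: v.
  by case/eigv=> a va; rewrite /c va mxE mulfK.
have nRyk k : (y ^- k)%g \in 'N(R)%g by rewrite groupV groupX.
pose f k x := c (x ^ (y ^- k))%g.
have vy k x : x \in R -> v *m rH (y ^+ k)%g *m rH x = f k x *: (v *m rH (y ^+ k)%g).
  move=> Rx; have Hx := subsetP sRH x Rx.
  rewrite -mulmxA -repr_mxM ?groupX //.
  have -> : (y ^+ k * x)%g = (x ^ (y ^- k) * y ^+ k)%g.
    by rewrite conjgE invgK -!mulgA mulVg mulg1.
  have Rxk : (x ^ (y ^- k))%g \in R by rewrite memJ_norm.
  by rewrite (repr_mxM rH (subsetP sRH _ Rxk) (groupX k Hy)) mulmxA vR // scalemxAl.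
have cXp k x : x \in R -> (x ^ (y ^- (p * k)))%g = x.
  move=> Rx; apply/conjg_fixP/commgP/commuteV.
  by rewrite expgM; apply/commuteX/commute_sym/(centP cyp).
have [dist | ] := boolP [forall i : 'I_p, forall j : 'I_p, (i != j) ==>
    [exists x in R, f i x != f j x]].
  pose A (x : [subg R]) := rH (val x).
  apply: (@eigenvectors_independent _ _ _ _ A (fun i => v *m rH (y ^+ i)%g)
          (fun i x => f i (val x))).
  - move=> i; apply: contraNneq nzv => v0.
    by rewrite -(repr_mxK rH (groupX i Hy) v) v0 mul0mx.
  - by move=> i x; apply/vy/subgP.
  move=> i j neq_ij; move/forallP/(_ i)/forallP/(_ j)/implyP/(_ neq_ij): dist.
  by case/exists_inP=> x Rx neq_f; exists (subg R x); rewrite /= subgK.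
move=> ndist.
have {ndist} [t /andP[t_gt0 t_ltp] eq_t] :
    exists2 t, (0 < t < p)%N & forall x, x \in R -> c x = f t x.
  move: ndist; rewrite negb_forall => /existsP[i]; rewrite negb_forall => /existsP[j].
  rewrite negb_imply negb_exists_in => /andP[neq_ij /forall_inP eq_f].
  wlog lt_ij : i j neq_ij eq_f / (i < j)%N.
    have := neq_ij; rewrite neq_ltn => /orP[] lt_ij IH; apply: IH lt_ij => //.
      by rewrite eq_sym.
    by move=> x Rx; rewrite eq_sym eq_f.
  exists (j - i)%N.
    by rewrite subn_gt0 lt_ij (leq_ltn_trans (leq_subr _ _)).
  move=> x Rx; have Rxi : (x ^ (y ^+ i))%g \in R by rewrite memJ_norm ?groupX.
  have /negbNE/eqP := eq_f _ Rxi.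
  rewrite /f -!conjgM mulgV conjg1 => ->; congr (c (_ ^ _)%g).
  rewrite -{1}(subnK (ltnW lt_ij)) expgD invMg mulgA mulgV mul1g //.
have cy x : x \in R -> c (x ^ y)%g = c x.
  move=> Rx.
  have ct k z : z \in R -> c z = f (t * k)%N z.
    elim: k z => [|k IHk] z Rz; first by rewrite muln0 /f expg0 invg1 conjg1.
    rewrite eq_t // /f IHk ?memJ_norm // /f -conjgM -invMg -expgD.
    by rewrite mulnS addnC.
  (* With $1 + ta = bp$, invariance of the weight under $y^t$ and the fact that $y^p$ centralizes
     [R] give invariance under $y$. *)
  have [a _ /dvdnP[b def_b]] := Bezoutl t (prime_gt0 p_pr).
  have cop : gcdn p t = 1%N.
    by apply/eqP; rewrite -[_ == _]/(coprime p t) prime_coprime // gtnNdvd.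
  rewrite cop in def_b.
  have Rxy : (x ^ y)%g \in R by rewrite memJ_norm.
  rewrite -[in LHS](cXp b _ Rxy) mulnC -def_b addnC addn1 mulnC expgSr invMg conjgM.
  rewrite -[LHS]/(c (((x ^ y) ^ y^-1) ^ _)%g) conjgK.
  by rewrite -[LHS]/(f (t * a)%N x) -ct.
(* The weight space of the invariant weight [c] is a nonzero submodule, hence everything; so [R]
   acts by scalars and commutes with [y]. *)
pose W := (\bigcap_(x in R) eigenspace (rH x) (c x))%MS.
have W_P (u : 'rV_d) : reflect (forall x, x \in R -> u *m rH x = c x *: u) (u <= W)%MS.
  by apply: (iffP sub_bigcapmxP) => eigu x Rx; have /eigenspaceP := eigu x Rx.
have nzW : W != 0.
  by apply: contraNneq nzv => W0; rewrite -submx0 -W0; apply/W_P.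
have cH h x : h \in H -> x \in R -> c (x ^ h)%g = c x.
  move=> /(subsetP sHRy)/mulsgP[z _ Rz /cycleP[k ->] ->] Rx.
  have -> : (x ^ (z * y ^+ k) = x ^ (y ^+ k))%g.
    by rewrite conjgM; congr (_ ^ _)%g; apply/conjg_fixP/commgP/(centsP abR).
  elim: k => [|k IHk]; first by rewrite expg0 conjg1.
  by rewrite expgSr conjgM cy ?memJ_norm ?groupX.
have modW : mxmodule rH W.
  apply/mxmoduleP=> h Hh; apply/row_subP=> i; rewrite row_mul; apply/W_P=> x Rx.
  have nRh : h \in 'N(R)%g.
    apply: subsetP Hh; apply: subset_trans sHRy _.
    by rewrite mul_subG ?normG // cycle_subG.
  have Rxh : (x ^ h^-1)%g \in R by rewrite memJ_norm ?groupV.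
  have /W_P eigi : (row i W <= W)%MS by apply: row_sub.
  rewrite -mulmxA -(repr_mxM rH Hh (subsetP sRH x Rx)).
  have -> : (h * x = x ^ h^-1 * h)%g by rewrite conjgE invgK -!mulgA mulVg mulg1.
  by rewrite (repr_mxM rH (subsetP sRH _ Rxh) Hh) mulmxA eigi // cH ?groupV // scalemxAl.
have [_ /(_ W modW nzW)] := (mx_irrP rH).1 irrH.
rewrite -sub1mx => /sub_bigcapmxP fullW; case/negP: ncy.
apply/centP=> x Rx; have Hx := subsetP sRH x Rx.
apply: (mx_faithful_inj faithH); rewrite ?groupM // !repr_mxM //.
have /eigenspaceP := fullW x Rx; rewrite mul1mx => ->.
by rewrite -scalemxAl -scalemxAr mul1mx mulmx1.
Qed.

End Eigenvectors.

(** * Sufficiency of the arithmetic conditions *)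

Section Sufficiency.

Local Open Scope group_scope.

Definition small_prime_condition (n : nat) : Prop :=
  forall p q, p \in primes n -> q \in primes n -> p != q ->
    (p <= logn q n)%N ->
  (~ exists2 r, r \in primes n & (p %| r - 1) && (r %| q - 1))
    /\ (logn p n <= 2)%N /\ (logn p n = 2 -> p ^ 2 %| q - 1).

(** * The minimal configuration: a faithful irreducible action of a group whose proper subgroups fix
    lines *)

Section IrreducibleAction.

Variables (n q : nat) (gT : finGroupType) (H N : {group gT}).
Hypotheses (n_gt0 : (0 < n)%N) (mocn : multiplicative_order_condition n).
Hypothesis spcn : small_prime_condition n.
Hypotheses (abN : q.-abelem N) (minN : minnormal N H) (cHN1 : 'C_H(N) = 1).
Hypotheses (H_n : #|H| %| n) (N_n : #|N| %| n) (coNH : coprime #|N| #|H|).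
Hypothesis N_not_prime : ~~ prime #|N|.
Hypothesis properH : forall M : {group gT}, M \proper H ->
  [/\ abelian M, {in M, forall x, x ^+ q.-1 = 1}
    & exists L : {group gT}, [/\ L \subset N, prime #|L| & M \subset 'N(L)]].

Let ntN : N :!=: 1. Proof. by have [/andP[]] := mingroupP minN. Qed.
Let nNH : H \subset 'N(N). Proof. by have [/andP[]] := mingroupP minN. Qed.
Let q_pr : prime q. Proof. by have [] := pgroup_pdiv (abelem_pgroup abN) ntN. Qed.
Let qN : q.-group N := abelem_pgroup abN.
Let q_N : q %| #|N|. Proof. by have [] := pgroup_pdiv qN ntN. Qed.
Let q_n : q \in primes n. Proof. by rewrite mem_primes q_pr n_gt0 (dvdn_trans q_N). Qed.
Let leqd : (logn q #|N| <= logn q n)%N. Proof. exact: dvdn_leq_log. Qed.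

(** An element of order $r$ acts nontrivially on the $q$-group [N], the action being faithful, so
    (1) applies. *)
Let primes_H r : prime r -> r %| #|H| -> [/\ r \in primes n, r != q & r %| q - 1].
Proof.
move=> r_pr r_H.
have r_n : r \in primes n by rewrite mem_primes r_pr n_gt0 (dvdn_trans r_H).
have neq_rq : r != q.
  apply: contraTneq coNH => eq_rq; rewrite coprime_sym.
  apply/negP=> /(coprime_dvdl r_H)/(coprime_dvdr q_N).
  by rewrite eq_rq /coprime gcdnn => /eqP q1; have := prime_gt1 q_pr; rewrite q1.
have [y Hy oy] := Cauchy r_pr r_H.
split=> //; apply: (order_condition_pelt n_gt0 mocn (p := q) (X := N) (y := y)) => //.
- by rewrite eq_sym.
- by rewrite /p_elt oy pnat_id.
- exact: (subsetP nNH).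
apply: contraL (prime_gt1 r_pr) => cNy; rewrite -oy -leqNgt leq_eqVlt order_eq1.
by rewrite -in_set1 -set1gE -cHN1 inE Hy cNy.
Qed.

Let abelian_absurd : abelian H -> #|H| %| q.-1 -> False.
Proof.
move=> abH H_q; case/negP: N_not_prime.
exact: (abelian_irreducible_line abN minN cHN1 abH).2.
Qed.

(** If $p$ did not divide $d = \log_q |N|$, [H] would fix a line. So $p \le d$, and (2)(b) makes [H]
    abelian of order dividing $q - 1$. *)
Let not_pgroup p : prime p -> ~~ p.-group H.
Proof.
move=> p_pr; apply/negP=> pH.
have [H1 | ntH] := eqsVneq H 1.
  by apply: abelian_absurd; rewrite H1 ?abelian1 // cards1 dvd1n.
have [_ p_H _] := pgroup_pdiv pH ntH.
have [p_n neq_pq p_q1] := primes_H p_pr p_H.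
have p_d : p %| logn q #|N|.
  apply: contraT => p'd; have p_q : p %| q.-1 by rewrite -subn1.
  have [L [sLN oL nLH]] := pgroup_invariant_line p_pr pH abN nNH ntN p_q p'd.
  have ntL : L :!=: 1 by rewrite -cardG_gt1 oL prime_gt1.
  case/negP: N_not_prime; have [_ minN'] := mingroupP minN.
  by rewrite -(minN' L) ?oL // ntL.
have d_gt0 : (0 < logn q #|N|)%N by rewrite logn_gt0 mem_primes q_pr cardG_gt0.
have le_p : (p <= logn q n)%N by apply: leq_trans leqd; apply: dvdn_leq.
have [_ [le2 p2q]] := spcn p_n q_n neq_pq le_p.
have le_log : (logn p #|H| <= logn p n)%N by apply: dvdn_leq_log.
apply: abelian_absurd; first by apply: p2group_abelian pH (leq_trans le_log le2).
rewrite -subn1 (card_pgroup pH).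
have [log2 | log1] := leqP 2 (logn p #|H|).
  have logn2 : logn p n = 2 by apply/eqP; rewrite eqn_leq le2 (leq_trans log2).
  by apply: dvdn_trans (p2q logn2); rewrite dvdn_exp2l // -logn2.
by apply: dvdn_trans p_q1; rewrite -[X in _ %| X]expn1 dvdn_exp2l.
Qed.

Let abelian_proper_exponent (M : {group gT}) : M \proper H -> cyclic M -> #|M| %| q.-1.
Proof.
move=> prM /cyclicP[x defM]; have [_ expM _] := properH prM.
rewrite defM -orderE order_dvdn expM //.
by rewrite -[x \in _]/(x \in gval M) defM cycle_id.
Qed.

(** An abelian [H] would be cyclic, with proper Sylow subgroups; these are cyclic of exponent
    dividing $q - 1$, so $|H|$ divides $q - 1$. *)
Let not_abelian : ~~ abelian H.
Proof.
apply/negP=> abH; apply: (abelian_absurd abH).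
have [cycH _] := abelian_irreducible_line abN minN cHN1 abH.
apply/dvdn_partP=> // p; rewrite mem_primes => /and3P[p_pr _ _].
have [S sylS] := Sylow_exists p H; have sSH := pHall_sub sylS.
rewrite -(card_Hall sylS); apply: abelian_proper_exponent; last exact: cyclicS cycH.
rewrite properEneq sSH andbT; apply: contra (not_pgroup p_pr) => /eqP <-.
exact: pHall_pgroup sylS.
Qed.

Lemma no_irreducible_action : False.
Proof.
have H_gt1 : (1 < #|H|)%N.
  by rewrite cardG_gt1; apply: contraNneq not_abelian => ->; apply: abelian1.
pose r := max_pdiv #|H|; have r_pr : prime r by rewrite max_pdiv_prime.
have [R sylR] := Sylow_exists r H; have [sRH rR r'R] := and3P sylR.
have nRH : R <| H by apply: (max_prime_Sylow_normal n_gt0 mocn H_n sylR).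
have r_H : r %| #|H| by apply: max_pdiv_dvd.
have prR : R \proper H.
  rewrite properEneq sRH andbT; apply: contra (not_pgroup r_pr) => /eqP <- //.
have [abR expR [L [sLN L_pr nLR]]] := properH prR.
have ntR : R :!=: 1.
  by rewrite -cardG_gt1 (card_Hall sylR) p_part_gt1 mem_primes r_pr cardG_gt0.
(* If all such elements centralized [R], then [R] would be central in [H], and an abelian complement
   would make [H] abelian. *)
have [p [y [p_pr neq_pr Hy py ncy]]] : exists p y,
    [/\ prime p, p != r, y \in H, p.-elt y & y \notin 'C(R)].
  have [/existsP[p /andP[/andP[p_pr neq_pr] /exists_inP[y Hy /andP[py ncy]]]] | none] :=
    boolP [exists p : 'I_(#|H|).+1, prime p && (p != r :> nat)
       && [exists y in H, p.-elt y && (y \notin 'C(R))]].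
    by exists p, y.
  case/negP: not_abelian.
  have cRH : H \subset 'C(R).
    rewrite -[H \subset _]andTb -(subxx H) -subsetI.
    suff : #|H| %| #|'C_H(R)|.
      by move=> /(dvdn_leq (cardG_gt0 _)) le; rewrite subEproper eq_sym eqEcard subsetIl le.
    apply/dvdn_partP=> // p; rewrite mem_primes => /and3P[p_pr _ p_H].
    have [S sylS] := Sylow_exists p H; have [sSH pS _] := and3P sylS.
    rewrite -(card_Hall sylS) cardSg // subsetI sSH /=.
    have [eq_pr | neq_pr] := eqVneq p r.
      suff -> : S :=: R by [].
      by rewrite eq_pr in sylS; rewrite -(normal_Hall_pcore sylR nRH); apply: eq_Hall_pcore => //; rewrite (normal_Hall_pcore sylR nRH).
    apply/subsetP=> y Sy; apply: contraR none => ncy.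
    have p_lt : (p < #|H|.+1)%N by rewrite ltnS dvdn_leq.
    apply/existsP; exists (Ordinal p_lt); rewrite p_pr neq_pr /=.
    by apply/exists_inP; exists y; rewrite ?(subsetP sSH) // (mem_p_elt pS Sy).
  have /splitsP[K /complP[tiRK defH]] := SchurZassenhaus_split (pHall_Hall sylR) nRH.
  have sKH : K \subset H by rewrite -defH mulG_subr.
  have prK : K \proper H.
    rewrite properEcard sKH -defH TI_cardMg // ltn_Pmull ?cardG_gt0 //.
    by rewrite cardG_gt1.
  have [abK _ _] := properH prK.
  by rewrite -defH abelianM abR abK (subset_trans sKH cRH).
have nRy : y \in 'N(R) by rewrite (subsetP (normal_norm nRH)).
have r'y : coprime #|R| #[y].
  apply: pnat_coprime rR _; apply: sub_in_pnat py => s _.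
  by rewrite !inE => /eqP->.
(* A proper subgroup $R\langle z\rangle$ would be abelian, and $z$ would centralize [R]. *)
have J_H z : z \in <[y]> -> z \notin 'C(R) -> H \subset R * <[z]>.
  move=> yz ncz; have Hz : z \in H by apply: subsetP yz; rewrite cycle_subG.
  have nRz : <[z]> \subset 'N(R) by rewrite cycle_subG (subsetP (normal_norm nRH)).
  rewrite -norm_joinEr //.
  have sJH : R <*> <[z]> \subset H by rewrite join_subG sRH cycle_subG.
  apply: contraR ncz => nsHJ.
  have [|abJ _ _] := @properH (R <*> <[z]>)%G; first by rewrite properE sJH.
  apply: subsetP (cycle_id z); apply: subset_trans (joing_subr R _) _.
  by apply: subset_trans abJ (centS (joing_subl _ _)).
have sHRy := J_H y (cycle_id y) ncy.
have p_y : p %| #[y].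
  have nty : y != 1 by apply: contraNneq ncy => ->; apply: group1.
  by have [] := pgroup_pdiv py; rewrite ?cycle_eq1 // => _ ->.
have p_H : p %| #|H| by apply: dvdn_trans p_y (order_dvdG Hy).
have [p_n neq_pq p_q] := primes_H p_pr p_H.
have [r_n neq_rq r_q] := primes_H r_pr r_H.
(* Otherwise $R\langle y^p\rangle$ would be all of [H], yet it is smaller than $R\langle
   y\rangle$. *)
have cyp : y ^+ p \in 'C(R).
  apply: contraT => /(J_H _ (mem_cycle y p)) sHyp.
  have sRyH : R * <[y]> \subset H by rewrite mul_subG ?cycle_subG.
  have := subset_leq_card (subset_trans sRyH sHyp).
  rewrite (coprime_cardMg r'y) => le1.
  have le2 : (#|(R * <[y ^+ p]>)%g| <= #|R| * #[(y ^+ p)%g])%N.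
    by rewrite -[#[_]]/#|<[_]>| mul_cardG leq_pmulr ?cardG_gt0.
  have := leq_trans le1 le2; rewrite leq_pmul2l ?cardG_gt0 // leqNgt.
  by rewrite orderXdiv // ltn_Pdiv ?prime_gt1 ?order_gt0.
have p_r : p %| r - 1.
  apply: (order_condition_pelt n_gt0 mocn (p := r) (X := R) (y := y)) => //.
    by rewrite eq_sym.
  by rewrite (dvdn_trans (cardSg sRH)).
(* The chain $p \mid r - 1$, $r \mid q - 1$ is forbidden by (2)(a) as soon as $p \le d$. *)
have lt_dp : (logn q #|N| < p)%N.
  rewrite ltnNge; apply/negP=> le_pd.
  have [no_r _] := spcn p_n q_n neq_pq (leq_trans le_pd leqd).
  by apply: no_r; exists r; rewrite ?p_r ?r_q.
have irrN := elimT (abelem_mx_irrP abN ntN nNH) minN.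
have faithN := abelem_mx_faithful abN ntN nNH cHN1.
have [l Ll ol] := Cauchy L_pr (dvdnn _).
have Nl := subsetP sLN l Ll.
have defL : L :=: <[l]>.
  by apply/eqP; rewrite eq_sym eqEcard cycle_subG Ll -orderE ol leqnn.
have ntl : l != 1 by rewrite -order_gt1 ol prime_gt1.
move: lt_dp; rewrite ltnNge => /negP[]; rewrite -(dim_abelemE abN ntN).
(* A generator [l] of the line fixed by [R] serves as weight vector. *)
apply: (irreducible_dim_ge (v := abelem_rV abN ntN l) p_pr faithN irrN sRH Hy) => //.
  apply: contra ntl => /eqP l0; apply/eqP.
  by apply: (abelem_rV_inj (abelE := abN) (ntE := ntN)); rewrite ?abelem_rV_1.
move=> x Rx; rewrite -abelem_rV_J ?(subsetP sRH) //.
have : l ^ x \in <[l]> by rewrite -defL memJ_norm // (subsetP nLR).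
by case/cycleP=> k ->; exists k%:R%R; rewrite abelem_rV_X.
Qed.

End IrreducibleAction.

(** All orders dividing $n$ are treated, so that induction on $|G|$ reaches subgroups and quotients.
    A normal subgroup of prime order settles the step; without one, [G] reduces to the minimal
    configuration. *)
Lemma conditions_supersolvable (n : nat) :
    (0 < n)%N -> multiplicative_order_condition n -> small_prime_condition n ->
  forall (gT : finGroupType) (G : {group gT}), #|G| %| n -> supersolvable G.
Proof.
move=> n_gt0 mocn spcn gT G; move: {2}_.+1 (ltnSn #|G|) => m.
elim: m gT G => // m IHm gT G; rewrite ltnS => leGm Gn.
have IH (rT : finGroupType) (X : {group rT}) :
    (#|X| < #|G|)%N -> #|X| %| n -> supersolvable X.
  by move=> ltXG; apply: IHm; apply: leq_trans leGm.
have [G1 | ntG] := eqsVneq G 1; first by rewrite G1; apply: supersolvable1.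
have IHq (K : {group gT}) : K <| G -> K :!=: 1 -> supersolvable (G / K).
  move=> nKG ntK; apply: IH; first by rewrite ltn_quotient ?normal_sub.
  exact: dvdn_trans (dvdn_quotient _ _) Gn.
have [/existsP[L /andP[nLG L_pr]] | none] := boolP [exists L : {group gT}, (L <| G) && prime #|L|].
  apply: (supersolvable_ext nLG (prime_cyclic L_pr)); apply: IHq => //.
  by rewrite -cardG_gt1 prime_gt1.
exfalso; have {}none (L : {group gT}) : L <| G -> prime #|L| -> False.
  by move=> nLG L_pr; case/existsP: none; exists L; rewrite nLG.
set q := max_pdiv #|G|; have q_pr : prime q by rewrite max_pdiv_prime ?cardG_gt1.
have [Q sylQ] := Sylow_exists q G; have [sQG qQ _] := and3P sylQ.
have nQG : Q <| G by apply: (max_prime_Sylow_normal n_gt0 mocn Gn sylQ).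
have ntQ : Q :!=: 1.
  by rewrite -cardG_gt1 (card_Hall sylQ) p_part_gt1 mem_primes q_pr cardG_gt0 max_pdiv_dvd.
have [N minN sNQ] := minnormal_exists ntQ (normal_norm nQG).
have [/andP[ntN nNG] minN'] := mingroupP minN.
have sNG := subset_trans sNQ sQG; have nnNG : N <| G by apply/andP.
have qN : q.-group N := pgroupS sNQ qQ.
have abN : q.-abelem N.
  rewrite -is_abelem_pgroup //.
  exact: charsimple_solvable (minnormal_charsimple minN) (pgroup_sol qN).
(* $N \cap Z(Q)$ is nontrivial because [Q] is nilpotent, and it is normal in [G], so it equals the
   minimal [N]. *)
have sNZ : N \subset 'Z(Q).
  have ntZ : N :&: 'Z(Q) != 1.
    exact: (meet_center_nil (pgroup_nil qQ) (normalS sNQ sQG nnNG) ntN).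
  rewrite -{1}(minN' (N :&: 'Z(Q))%G) ?subsetIl ?subsetIr //=.
  by rewrite ntZ normal_norm // normalI // gFnormal_trans.
have cQN : Q \subset 'C(N) by rewrite centsC (subset_trans sNZ) ?subsetIr.
have /splitsP[H /complP[tiQH defG]] := SchurZassenhaus_split (pHall_Hall sylQ) nQG.
have sHG : H \subset G by rewrite -defG mulG_subr.
have nNH : H \subset 'N(N) := subset_trans sHG nNG.
have oG : #|G| = (#|Q| * #|H|)%N by rewrite -defG TI_cardMg.
have q'H : q^'.-group H.
  have /and3P[_ _] := sylQ.
  by rewrite -divgS // oG mulKn ?cardG_gt0.
have coQH : coprime #|Q| #|H| by apply: pnat_coprime qQ q'H.
have card_NM (M : {group gT}) : M \subset H -> #|N <*> M| = (#|N| * #|M|)%N.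
  move=> sMH; rewrite norm_joinEr ?(subset_trans sMH) // TI_cardMg //.
  by apply/trivgP; rewrite -tiQH setISS.
(* Otherwise $NH$ is smaller than [G], hence supersolvable, and has a normal subgroup [L] of prime
   order in [N]; [Q] centralizes [L], so [L] is normal in $QH = G$. *)
have defQ : N :=: Q.
  apply/eqP; rewrite eqEcard sNQ leqNgt; apply/negP=> ltNQ.
  have ssNH : supersolvable (N <*> H).
    apply: IH; first by rewrite card_NM // oG ltn_pmul2r.
    by rewrite (dvdn_trans _ Gn) // cardSg // join_subG sNG.
  have nNNH : N <| N <*> H by rewrite normalYl.
  have [L [nL sLN L_pr]] := supersolvable_prime_normal ssNH nNNH ntN.
  apply: (none L) => //; rewrite /normal (subset_trans sLN) //= -defG mul_subG //.
    by rewrite (subset_trans cQN) // (subset_trans (centS sLN)) ?cent_sub.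
  by rewrite (subset_trans (joing_subr N H)) ?normal_norm.
rewrite -defQ in coQH tiQH oG defG.
have abN' := abelem_abelian abN.
(* $C_H(N)$ is normal in [G]; were it nontrivial, the quotient by it would be supersolvable and
   yield a normal subgroup of prime order inside [N]. *)
have cHN1 : 'C_H(N) = 1.
  apply/eqP; apply: contraT => ntK.
  have nKG : 'C_H(N)%G <| G.
    rewrite /normal subIset ?sHG //= -defG mul_subG //.
      by rewrite cents_norm // centsC subsetIr.
    by rewrite -{1}(setIidPl nNH) normal_norm // subcent_normal.
  have [|L [nLG _ L_pr]] := quotient_supersolvable_prime_normal nKG (IHq _ nKG ntK) nnNG ntN.
    by apply/trivgP; rewrite /= -tiQH setIC setISS ?subsetIl.
  by case: (none L nLG L_pr).
have minNH : minnormal N H.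
  apply/mingroupP; split=> [|L /andP[ntL nLH] sLN]; first by rewrite ntN.
  apply: minN' => //; rewrite ntL -defG mul_subG //.
  by rewrite cents_norm // (subset_trans abN') ?centS.
apply: (no_irreducible_action n_gt0 mocn spcn abN minNH cHN1) => //.
- by rewrite (dvdn_trans (cardSg sHG)).
- by rewrite (dvdn_trans (cardSg sNG)).
- by apply/negP=> /(none N nnNG).
move=> M prM; have sMH := proper_sub prM.
have sNMG : N <*> M \subset G by rewrite join_subG sNG (subset_trans sMH).
have ssNM : supersolvable (N <*> M).
  apply: IH; first by rewrite card_NM // oG ltn_pmul2l ?cardG_gt0 ?proper_card.
  by rewrite (dvdn_trans (cardSg sNMG)).
have nNNM : N <| N <*> M by rewrite normalYl (subset_trans sMH).
have cMN1 : 'C_M(N) = 1 by apply/trivgP; rewrite -cHN1 setSI.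
have coNM : coprime #|N| #|M| by rewrite (coprime_dvdr (cardSg sMH)).
have [abM expM] := supersolvable_coprime_factor ssNM nNNM (joing_subr _ _) abN coNM cMN1.
have [L [nL sLN L_pr]] := supersolvable_prime_normal ssNM nNNM ntN.
split=> //; exists L; split=> //.
by rewrite (subset_trans (joing_subr N M)) ?normal_norm.
Qed.

End Sufficiency.

(** * Non-supersolvable groups *)

Section NormalLine.

Local Open Scope group_scope.
Import GRing.Theory.

Definition supersolvable_number (n : nat) : Prop :=
  forall (gT : finGroupType) (G : {group gT}), #|G| = n -> supersolvable G.

(* Applied to (F_q^d ><| G) x C for a cyclic group C of the complementary order. *)
Lemma supersolvable_number_eigenvector (n q d : nat) (gT : finGroupType)
    (G : {group gT}) (rG : mx_representation 'F_q G d) :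
    (0 < n)%N -> supersolvable_number n -> prime q -> (0 < d)%N ->
    (q ^ d * #|G|)%N %| n ->
  exists2 v : 'rV['F_q]_d, v != 0%R & forall g, g \in G -> exists c, (v *m rG g = c *: v)%R.
Proof.
move=> n_gt0 ssn q_pr d_gt0 /dvdnP[k def_n].
pose sdT := sdprod_groupType ('MR rG)%gact.
(* The cofactor is nonzero; written $k + 1$, it is the order of the cyclic group ['I_k.+1]. *)
case: k def_n => [n0 | k def_n]; first by rewrite n0 in n_gt0.
pose f (v : 'rV['F_q]_d) : sdT := sdpair1 ('MR rG)%gact v.
pose h (g : gT) : sdT := sdpair2 ('MR rG)%gact g.
pose X := [set: (sdT * 'I_k.+1)%type].
have cardV : #|[set: 'rV['F_q]_d]| = (q ^ d)%N by rewrite cardsT card_mx card_Fp // mul1n.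
have oV : #|sdpair1 ('MR rG)%gact @* setT| = (q ^ d)%N.
  by rewrite card_injm ?injm_sdpair1.
have oX : #|X| = n.
  have := sdprod_card (sdprod_sdpair ('MR rG)%gact).
  rewrite oV card_injm ?injm_sdpair2 // => oS.
  by rewrite def_n oS /X !cardsT card_prod card_ord mulnC.
have ssX := ssn _ [set: _]%G oX.
pose V1 := (pairg1 'I_k.+1 @* (sdpair1 ('MR rG)%gact @* setT))%G.
have V1P v : pairg1 'I_k.+1 (f v) \in V1.
  by rewrite !mem_morphim ?inE.
have nV1 : V1 <| [set: _].
  rewrite /normal subsetT /=; apply/subsetP=> -[u z] _.
  have [nV _ _ _ _] := sdprod_context (sdprod_sdpair ('MR rG)%gact).
  have nu : u \in 'N(sdpair1 ('MR rG)%gact @* setT).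
    by apply: (subsetP (normal_norm nV)); rewrite inE.
  rewrite inE morphim_pairg1; apply/subsetP=> _ /imsetP[[a b] /setXP[Va /set1P-> ->]].
  rewrite -[(a, 1) ^ _]/(a ^ u, 1 ^ z) conj1g.
  by rewrite in_setX memJ_norm // Va group1.
have ntV1 : V1 :!=: 1.
  rewrite -cardG_gt1 card_injm ?injm_pairg1 ?subsetT // oV.
  by rewrite -(exp1n d) ltn_exp2r ?prime_gt1.
have [L [nLX sLV L_pr]] := supersolvable_prime_normal ssX nV1 ntV1.
have [l Ll ol] := Cauchy L_pr (dvdnn _).
have defL : L :=: <[l]>.
  by apply/eqP; rewrite eq_sym eqEcard cycle_subG Ll -orderE ol leqnn.
have /morphimP[fv _ /morphimP[v _ _ ->] def_l] := subsetP sLV l Ll.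
exists v.
  apply: contraTneq (prime_gt1 L_pr) => v0; rewrite -ol def_l v0.
  by rewrite (morph1 (sdpair1_morphism _)) morph1 order1.
move=> g Gg.
(* Conjugation by [g] sends the generator of [L] to a power of it; written additively, [v] is an
   eigenvector. *)
have : l ^ pairg1 _ (h g) \in <[l]>.
  by rewrite -defL memJ_norm // (subsetP (normal_norm nLX)) ?inE.
case/cycleP=> e; rewrite def_l -morphJ ?inE // -morphX ?inE //.
move/(injmP (injm_pairg1 _ _)); rewrite !inE => /(_ isT isT).
rewrite -sdpair_act ?inE // -morphX ?inE // => /(injmP (injm_sdpair1 _)).
rewrite !inE => /(_ isT isT) /= def_vg.
by exists e%:R%R; rewrite scaler_nat -mx_repr_actE // def_vg.
Qed.

End NormalLine.

(** * Matrix groups without a common eigenvector *)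

Section Necessity.

Local Open Scope group_scope.
Import GRing.Theory.
Local Open Scope ring_scope.

Lemma expf_coprime_eq1 (F : fieldType) (x : F) (a b : nat) :
  (0 < a)%N -> coprime a b -> x ^+ a = 1 -> x ^+ b = 1 -> x = 1.
Proof.
move=> a_gt0 /eqP co_ab xa xb; have [u _ /dvdnP[k]] := Bezoutl b a_gt0.
rewrite co_ab => def_k; rewrite -[x]expr1 -[LHS]mulr1.
by rewrite -{1}(expr1n _ u) -{1}xb -exprM mulnC -exprD def_k mulnC exprM xa expr1n.
Qed.

Lemma supersolvable_number_GL_eigenvector (n q d : nat)
    (G : {group {'GL_d.+1['F_q]}}) :
    (0 < n)%N -> supersolvable_number n -> prime q ->
    (q ^ d.+1 * #|G| %| n)%N ->
  exists2 v : 'rV['F_q]_d.+1, v != 0 &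
    forall g, g \in G -> exists c, v *m GLval g = c *: v.
Proof.
move=> n_gt0 ssn q_pr q_n; have sG := subsetT G.
exact: (supersolvable_number_eigenvector (subg_repr (GLrepr _ d) sG) n_gt0 ssn q_pr).
Qed.

Lemma Fp_exp_card (q : nat) (c : 'F_q) : prime q -> c != 0 -> c ^+ q.-1 = 1.
Proof.
move=> q_pr nzc; apply: (mulfI nzc).
by rewrite -exprS prednK ?prime_gt0 // mulr1; have := expf_card c; rewrite card_Fp.
Qed.

Lemma eigenvalue_neq0 (q d : nat) (g : {'GL_d.+1['F_q]}) (v : 'rV_d.+1) c :
  v != 0 -> v *m GLval g = c *: v -> c != 0.
Proof.
move=> nzv vg; apply: contraNneq nzv => c0.
by rewrite -(mulmxK (GL_unitmx g) v) -[\val g]/(GLval g) vg c0 scale0r mul0mx.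
Qed.

Lemma eigenvector_exp (R : comNzRingType) d (A : 'M[R]_d.+1) (v : 'rV_d.+1) c k :
  v *m A = c *: v -> v *m (A ^+ k) = c ^+ k *: v.
Proof.
move=> vA; elim: k => [|k IHk]; first by rewrite !expr0 mulmx1 scale1r.
by rewrite exprSr -[_ * A]/(_ *m A) mulmxA IHk -scalemxAl vA scalerA exprSr.
Qed.

Lemma GLval_exp (q d : nat) (g : {'GL_d.+1['F_q]}) k : GLval (g ^+ k)%g = GLval g ^+ k.
Proof. by elim: k => // k IHk; rewrite expgS exprS -IHk. Qed.

(** Let $j$ ([j.+1] in the proof) be least with $q \mid p^j - 1$, and [A] of order $q$ in $GL_j(p)$.
    If $q \nmid p - 1$, its eigenvector has eigenvalue 1, so its fixed space has dimension $f$ with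
    $0 < f < j$; counting fixed vectors modulo $q$ gives $q \mid p^{j-f} - 1$, against
    minimality. *)
Lemma supersolvable_number_order_condition (n : nat) :
  (0 < n)%N -> supersolvable_number n -> multiplicative_order_condition n.
Proof.
move=> n_gt0 ssn p q j0 p_n q_n j0P q_j0.
have p_pr : prime p by move: p_n; rewrite mem_primes => /and3P[].
have q_pr : prime q by move: q_n; rewrite mem_primes => /and3P[].
have ex_j : exists j, (0 < j)%N && (q %| p ^ j - 1)%N.
  by exists j0; rewrite q_j0; case/andP: j0P => ->.
case: (ex_minnP ex_j) => -[|j] // /andP[_ q_j] min_j.
have le_j : (j.+1 <= logn p n)%N.
  by case/andP: j0P => j_gt0; apply: leq_trans; apply: min_j; rewrite j_gt0.
apply: contraT => q'p.
have neq_qp : q != p.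
  apply: contraL q_j => /eqP->.
  by rewrite -prime_coprime // -(@coprime_pexpl j.+1) // subn1 coprimenP // expn_gt0 prime_gt0.
have q_GL : (q %| #|'GL_j.+1['F_p]|)%N.
  rewrite card_GL // card_Fp // dvdn_mull // big_nat_recr //= dvdn_mull //.
have [A _ oA] := Cauchy q_pr q_GL.
have pq_n : (p ^ j.+1 * #|<[A]>%g| %| n)%N.
  rewrite -orderE oA Gauss_dvd; last by rewrite coprimeXl // prime_coprime // dvdn_prime2 // eq_sym.
  by rewrite pfactor_dvdn // le_j; move: q_n; rewrite mem_primes => /and3P[].
have [v nzv eigv] := supersolvable_number_GL_eigenvector (G := <[A]>%G) n_gt0 ssn p_pr pq_n.
have [c vA] := eigv A (cycle_id A).
have c1 : c = 1.
  have nzc := eigenvalue_neq0 nzv vA.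
  apply: (@expf_coprime_eq1 _ _ q p.-1); rewrite ?prime_gt0 ?Fp_exp_card //.
    by rewrite prime_coprime // -subn1.
  have := eigenvector_exp q vA; rewrite -GLval_exp -oA expg_order mulmx1.
  rewrite -[X in X = _]scale1r => /eqP; rewrite -subr_eq0 -scalerBl scaler_eq0.
  by rewrite (negPf nzv) orbF subr_eq0 => /eqP.
set rG := subg_repr (GLrepr 'F_p j) (subsetT <[A]>%G).
have qG : q.-group <[A]>%G by rewrite /pgroup -orderE oA pnat_id.
have actG : [acts <[A]>%g, on setT | 'MR rG] by apply/subsetP=> g Gg; rewrite !inE Gg; apply/subsetP=> u; rewrite !inE.
have := pgroup_fix_mod qG actG; rewrite setTI afix_repr // card_rowg.
rewrite cardsT card_mx mul1n card_Fp // => /eqP.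
set f := \rank _ => mod_f.
have f_le : (f <= j.+1)%N by apply: rank_leq_col.
have fix_v : (v <= rfix_mx rG <[A]>%g)%MS.
  apply/rfix_mxP=> g /cycleP[k ->]; rewrite -[_ (A ^+ k)%g]/(GLval (A ^+ k)%g) GLval_exp.
  by rewrite (eigenvector_exp k vA) c1 expr1n scale1r.
have f_gt0 : (0 < f)%N.
  by rewrite lt0n mxrank_eq0; apply: contraNneq nzv => fix0; rewrite -submx0 -fix0.
have f_lt : (f < j.+1)%N.
  rewrite ltn_neqAle f_le andbT; apply: contraTneq (prime_gt1 q_pr) => f_full.
  have : (1%:M <= rfix_mx rG <[A]>%g)%MS by rewrite sub1mx -col_leq_rank -/f f_full.
  move/rfix_mxP/(_ A (cycle_id A)); rewrite mul1mx => A1.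
  by rewrite -oA (_ : A = 1%g) ?order1 //; apply: val_inj.
have : (q %| p ^ (j.+1 - f) - 1)%N.
  move: mod_f; rewrite eqn_mod_dvd ?leq_exp2l ?prime_gt1 //.
  rewrite -{1}(subnKC f_le) expnD -{2}[(p ^ f)%N]muln1 -mulnBr Gauss_dvdr //.
  by rewrite coprimeXr // prime_coprime // dvdn_prime2.
move=> q_jf; have := min_j (j.+1 - f)%N; rewrite subn_gt0 f_lt q_jf => /(_ isT).
by rewrite leqNgt ltn_subrL f_gt0.
Qed.

Lemma GL_lift (F : finFieldType) (d : nat) (M : 'M[F]_d.+1) :
  M \in unitmx -> exists g : {'GL_d.+1[F]}, GLval g = M.
Proof.
by move=> uM; exists (insubd (1%g : {'GL_d.+1[F]}) M); rewrite -[LHS]/(val _) val_insubd -[_ \is a GRing.unit]/(M \in unitmx) uM.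
Qed.

Lemma card_join_cycle_dvd (gT : finGroupType) (A : {group gT}) (s : gT) :
  s \in 'N(A)%g -> (#|(A <*> <[s]>)%g| %| #|A| * #[s]%g)%N.
Proof.
move=> nAs; rewrite norm_joinEr ?cycle_subG // -[#[s]%g]/#|<[s]>%g| mul_cardG.
exact: dvdn_mulr.
Qed.

Lemma norm_cycle (gT : finGroupType) (x s : gT) k :
  (s * x = x ^+ k * s)%g -> s \in 'N(<[x]>)%g.
Proof.
move=> sx; rewrite -groupV inE -cycleJ cycle_subG conjgE invgK mulgA sx mulgK.
exact: mem_cycle.
Qed.

Lemma norm_joing_cycles (gT : finGroupType) (z x s : gT) :
  commute z s -> (s * x = z * x * s)%g -> s \in 'N(<[z]> <*> <[x]>)%g.
Proof.
move=> czs sx; have [Jz Jx] : z \in <[z]> <*> <[x]> /\ x \in <[z]> <*> <[x]>.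
  by split; rewrite mem_gen // inE cycle_id ?orbT.
rewrite -groupV inE conjYg -!cycleJ join_subG !cycle_subG /=.
have -> : (z ^ s^-1 = z)%g by apply/conjg_fixP/commgP/commuteV.
by rewrite Jz conjgE invgK mulgA sx mulgK groupM.
Qed.

Lemma order_dvd_expg1 (gT : finGroupType) (x : gT) k : (#[x] %| k)%N -> (x ^+ k)%g = 1%g.
Proof. by move=> xk; apply/eqP; rewrite -order_dvdn. Qed.

Definition cycle_mx (R : comNzRingType) (d : nat) : 'M[R]_d.+1 :=
  perm_mx (perm (@ordS_inj d.+1)).

Lemma cycle_mx_diag (R : comNzRingType) d (a : 'rV[R]_d.+1) :
  cycle_mx R d *m diag_mx a = diag_mx (\row_i a 0 (ordS i)) *m cycle_mx R d.
Proof.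
apply/matrixP=> i j; rewrite mul_diag_mx mul_mx_diag !mxE permE mulrC.
by case: eqP => [-> | _] //; rewrite !mulr0.
Qed.

Lemma cycle_mx_exp (R : comNzRingType) d : cycle_mx R d ^+ d.+1 = 1.
Proof.
have expS k : cycle_mx R d ^+ k = perm_mx (perm (@ordS_inj d.+1) ^+ k)%g.
  elim: k => [|k IHk]; first by rewrite perm_mx1.
  by rewrite exprS expgS IHk perm_mxM.
rewrite expS (_ : (_ ^+ _)%g = 1%g) ?perm_mx1 //.
apply/permP=> i; rewrite permX perm1; apply: val_inj.
have -> k : val (iter k (perm (@ordS_inj d.+1)) i) = ((i + k) %% d.+1)%N.
  elim: k => [|k IHk]; first by rewrite addn0 modn_small.
  by rewrite iterS permE /= IHk -[((i + k) %% _).+1]addn1 modnDml addn1 addnS.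
by rewrite modnDr modn_small.
Qed.

Lemma diag_mx_exp (R : comNzRingType) d (a : 'rV[R]_d.+1) k :
  diag_mx a ^+ k = diag_mx (\row_i a 0 i ^+ k).
Proof.
elim: k => [|k IHk].
  by rewrite expr0; apply/matrixP=> i j; rewrite !mxE expr0.
rewrite exprS IHk; apply/matrixP=> i j.
by rewrite -[_ * diag_mx _]/(_ *m diag_mx _) mul_diag_mx !mxE exprS mulrnAr.
Qed.

Lemma order_GL_dvd (q d : nat) (g : {'GL_d.+1['F_q]}) k :
  GLval g ^+ k = 1 -> (#[g]%g %| k)%N.
Proof. by move=> gk; rewrite order_dvdn; apply/eqP/val_inj; have := GLval_exp g k; rewrite gk. Qed.

Lemma Fermat_pred (p q : nat) : prime p -> prime q -> p != q -> (p %| q ^ p.-1 - 1)%N.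
Proof.
move=> p_pr q_pr neq_pq; rewrite -eqn_mod_dvd ?expn_gt0 ?prime_gt0 //.
rewrite -totient_prime //; apply/eqP/Euler_exp_totient.
by rewrite prime_coprime // dvdn_prime2 // eq_sym.
Qed.

Lemma dvdn_pred_lt (a b : nat) : (1 < b)%N -> (a %| b.-1)%N -> (a < b)%N.
Proof. by case: b => [|[|b]] //= _ /dvdn_leq; rewrite ltnS; apply. Qed.

(** The companion matrix of $X^{d+1} - w$ works, by Cayley-Hamilton. *)
Lemma nth_root_mx (F : fieldType) d (w : F) : exists A : 'M[F]_d.+1, A ^+ d.+1 = w%:M.
Proof.
pose P : {poly F} := 'X^(d.+1) - w%:P.
have monP : P \is monic by apply: monicXnsubC.
have := companionmxK monP; move: (companionmx P).
have -> : (size P).-1 = d.+1 by rewrite size_XnsubC.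
move=> A charA; exists A; apply/eqP; rewrite -subr_eq0 -(Cayley_Hamilton A) charA.
by rewrite rmorphB rmorphXn /= horner_mx_X horner_mx_C.
Qed.

(** * The case $p_i \le a_k$: matrices of size $p$ over the field of $q$ elements *)

Section SmallPrime.

Variables (n p d q : nat).
Hypotheses (n_gt0 : (0 < n)%N) (ssn : supersolvable_number n).
Hypotheses (p_pr : prime p) (q_pr : prime q) (def_p : p = d.+1).
Hypotheses (p_n : p \in primes n) (q_n : q \in primes n) (neq_pq : p != q).
Hypotheses (le_p : (p <= logn q n)%N) (p_q : (p %| q.-1)%N).

(** The vectors contribute $q^p$ to the order, and $q^p k$ divides $n$ because $p$ is at most the
    exponent of $q$ in $n$. *)
Let GL_eigenvector k (G : {group {'GL_d.+1['F_q]}}) :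
    (k %| n)%N -> coprime q k -> (#|G| %| k)%N ->
  exists2 v : 'rV['F_q]_d.+1, v != 0 &
    forall g, g \in G -> exists c, v *m GLval g = c *: v.
Proof.
move=> k_n co_qk G_k; apply: supersolvable_number_GL_eigenvector n_gt0 ssn q_pr _.
apply: (@dvdn_trans (q ^ d.+1 * k)%N); first by rewrite dvdn_pmul2l ?expn_gt0 ?prime_gt0.
by rewrite Gauss_dvd ?coprimeXl // k_n pfactor_dvdn // -def_p le_p.
Qed.

Let coprime_qp : coprime q p.
Proof. by rewrite prime_coprime // dvdn_prime2 // eq_sym. Qed.

Let cycle_GL : exists S : {'GL_d.+1['F_q]},
  GLval S = cycle_mx 'F_q d /\ (#[S]%g %| p)%N.
Proof.
have [S defS] := GL_lift (unitmx_perm 'F_q (perm (@ordS_inj d.+1))).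
exists S; split=> //; apply: order_GL_dvd.
by rewrite defS def_p cycle_mx_exp.
Qed.

Let diag_GL (a : 'rV['F_q]_d.+1) k : (forall i, a 0 i ^+ k = 1) -> (0 < k)%N ->
  exists D : {'GL_d.+1['F_q]}, GLval D = diag_mx a /\ (#[D]%g %| k)%N.
Proof.
move=> ak k_gt0; have [|D defD] := @GL_lift 'F_q d (diag_mx a).
  rewrite unitmxE det_diag unitfE; apply/prodf_neq0=> i _.
  by apply: contra_eq_neq (ak i) => ->; rewrite expr0n gtn_eqF // eq_sym oner_neq0.
exists D; split=> //; apply: order_GL_dvd; rewrite defD diag_mx_exp.
by apply/matrixP=> i j; rewrite !mxE ak.
Qed.

(* A matrix [A] with [A ^ p = w] has no eigenvalue in F_q when [w] is not a [p]-th power. *)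
Lemma square_dvd_pred : logn p n = 2%N -> (p ^ 2 %| q.-1)%N.
Proof.
move=> log2; have [w prim_w] := Fp_prim_root q_pr p_q.
have [M Mpd] := nth_root_mx d w.
have Mp : M ^+ p = w%:M by rewrite def_p.
have wp : w ^+ p = 1 by apply: prim_expr_order.
have Mp2 : M ^+ (p ^ 2) = 1 by rewrite -mulnn exprM Mp -rmorphXn wp.
have uM : M \in unitmx.
  suff : M * M ^+ (p ^ 2).-1 = 1 by case/mulmx1_unit.
  by rewrite -exprS prednK ?expn_gt0 ?prime_gt0.
have [A defA] := GL_lift uM.
have p2_n : (p ^ 2 %| n)%N by rewrite pfactor_dvdn // log2.
have oA : (#|<[A]>%g| %| p ^ 2)%N by apply: order_GL_dvd; rewrite defA.
have [v nzv eigv] := GL_eigenvector p2_n (coprimeXr 2 coprime_qp) oA.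
have [c vA] := eigv A (cycle_id A).
have nzc := eigenvalue_neq0 nzv vA.
have cp : c ^+ p = w.
  have := eigenvector_exp p vA; rewrite defA Mp mul_mx_scalar => /eqP.
  by rewrite -subr_eq0 -scalerBl scaler_eq0 (negPf nzv) orbF subr_eq0 => /eqP.
have cp2 : c ^+ (p ^ 2) = 1 by rewrite -mulnn exprM cp.
have [|m prim_c] := prim_order_exists _ cp2; first by rewrite expn_gt0 prime_gt0.
case/(dvdn_pfactor _ _ p_pr)=> k le_k2 def_m; rewrite {}def_m in prim_c.
(* The order $p^k$ of [c] divides $q - 1$, which suffices if $k = 2$; if $k < 2$ then $w = c^p = 1$,
   which is absurd. *)
have [k2 | k_lt2] := eqVneq k 2%N.
  by rewrite -k2 (prim_order_dvd prim_c) Fp_exp_card.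
have w1 : w = 1.
  rewrite -cp; apply/eqP; rewrite -(prim_order_dvd prim_c).
  by rewrite -[X in (_ %| X)%N]expn1 dvdn_exp2l // -ltnS ltn_neqAle k_lt2.
by have := prim_order_dvd prim_w 1; rewrite w1 expr1n eqxx dvdn1 gtn_eqF ?prime_gt1.
Qed.

(* The clock and shift matrices commute up to the scalar [w], of order [p]. *)
Lemma logn_le2 : (logn p n <= 2)%N.
Proof.
rewrite leqNgt; apply/negP=> log3; have [w prim_w] := Fp_prim_root q_pr p_q.
have wp : w ^+ p = 1 by apply: prim_expr_order.
have p_gt0 := prime_gt0 p_pr.
have [S [defS oS]] := cycle_GL.
have [//|//|D [defD oD]] := @diag_GL (\row_i w ^+ i) p.
  by move=> i; rewrite mxE exprAC wp expr1n.
have [//|//|Z [defZ oZ]] := @diag_GL (const_mx w) p.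
  by move=> i; rewrite mxE wp.
have cZ g : commute Z g.
  apply: val_inj; rewrite /= -[LHS]/(GLval Z *m GLval g) -[RHS]/(GLval g *m GLval Z).
  by rewrite defZ diag_const_mx scalar_mxC.
have SD : (S * D = Z * D * S)%g.
  apply: val_inj; rewrite /= -[LHS]/(GLval S *m GLval D).
  rewrite -[RHS]/(GLval Z *m GLval D *m GLval S) defS defD defZ cycle_mx_diag.
  congr (_ *m _); rewrite diag_const_mx mul_scalar_mx.
  apply/matrixP=> i j; rewrite !mxE mulrnAr -exprS; congr (_ *+ _).
  by rewrite /= expr_mod // -def_p.
pose A := (<[Z]> <*> <[D]>)%G.
have AD : D \in A by rewrite mem_gen // inE cycle_id orbT.
have AZ : Z \in A by rewrite mem_gen // inE cycle_id.
have nAS : S \in 'N(A)%g := norm_joing_cycles (cZ S) SD.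
have oA : (#|A| %| p * p)%N.
  apply: (@dvdn_trans (#|<[Z]>%g| * #[D]%g)%N); last by rewrite dvdn_mul.
  apply: card_join_cycle_dvd; apply: (subsetP (cent_sub _)).
  by rewrite cent_cycle; apply/cent1P/commute_sym.
have oAS : (#|(A <*> <[S]>)%g| %| p ^ 3)%N.
  by rewrite !expnSr expn0 mul1n; apply: dvdn_trans (card_join_cycle_dvd nAS) _; rewrite dvdn_mul.
have p3_n : (p ^ 3 %| n)%N by rewrite pfactor_dvdn.
have [v nzv eigv] := GL_eigenvector p3_n (coprimeXr 3 coprime_qp) oAS.
have sAJ : A \subset (A <*> <[S]>)%g by apply: joing_subl.
have [e vD] := eigv D (subsetP sAJ D AD).
have JS : S \in (A <*> <[S]>)%g by rewrite mem_gen // inE cycle_id orbT.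
have [s vS] := eigv S JS.
have nze := eigenvalue_neq0 nzv vD; have nzs := eigenvalue_neq0 nzv vS.
(* On a common eigenvector the eigenvalues of [S] and [D] cancel from $SD = ZDS$, leaving $w =
   1$. *)
have : v *m GLval (S * D)%g = v *m GLval (Z * D * S)%g by rewrite SD.
rewrite -[GLval (S * D)]/(GLval S *m GLval D) -[GLval (Z * D * S)]/(GLval Z *m GLval D *m GLval S).
rewrite !mulmxA vS -scalemxAl vD scalerA defZ diag_const_mx mul_mx_scalar.
rewrite -!scalemxAl vD -scalemxAl vS !scalerA => /eqP.
rewrite -subr_eq0 -scalerBl scaler_eq0 (negPf nzv) orbF -mulrA (mulrC s) subr_eq0.
rewrite -[X in X == _]mul1r (inj_eq (mulIf (mulf_neq0 nze nzs))) eq_sym => /eqP w1.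
by have := prim_order_dvd prim_w 1; rewrite w1 expr1n eqxx dvdn1 gtn_eqF ?prime_gt1.
Qed.

Lemma no_intermediate_prime (r : nat) :
  r \in primes n -> (p %| r - 1)%N -> (r %| q - 1)%N -> False.
Proof.
move=> r_n p_r r_q; have /and3P[r_pr _ rn] : [&& prime r, 0 < n & r %| n]%N by rewrite -mem_primes.
rewrite subn1 in p_r; rewrite subn1 in r_q.
have p_gt1 := prime_gt1 p_pr; have p_gt0 := prime_gt0 p_pr; have r_gt1 := prime_gt1 r_pr.
have lt_pr : (p < r)%N.
  exact: dvdn_pred_lt.
have lt_rq : (r < q)%N.
  by rewrite dvdn_pred_lt ?prime_gt1.
have [t prim_t] := Fp_prim_root r_pr p_r.
have [z prim_z] := Fp_prim_root q_pr r_q.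
(* Exponents of [z] matter only modulo [r], so [t], of order $p$, is replaced by an integer [T];
   $T^p \equiv 1$ then closes the cycle in $S D S^{-1} = D^T$. *)
pose T := nat_of_ord t.
have def_t : t = T%:R by rewrite natr_Zp.
have zT a b : a = b %[mod r] -> z ^+ a = z ^+ b.
  by move=> /eqP ab; apply/eqP; rewrite (eq_prim_root_expr prim_z).
have Tmod a b : (T ^ a = T ^ b %[mod r])%N <-> t ^+ a = t ^+ b.
  rewrite def_t -!natrX; split=> [eq_ab | /(congr1 val)]; last first.
    by rewrite /= !val_Fp_nat.
  by apply: val_inj; rewrite /= !val_Fp_nat.
have Tp : (T ^ p = 1 %[mod r])%N by apply/(Tmod p 0%N); rewrite prim_expr_order.
have T_neq1 : t != 1.
  apply: contraTneq p_gt1 => t1; have := prim_order_dvd prim_t 1.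
  by rewrite t1 expr1n eqxx dvdn1 => /eqP->.
have T_neq0 : t != 0.
  by apply: contraTneq p_gt0 => t0; have := prim_root_eq0 prim_t; rewrite t0 eqxx => /esym/eqP->.
have lt_Tr : (T < r)%N by rewrite /T -[X in (_ < X)%N](Fp_cast r_pr) ltn_ord.
have T_gt1 : (1 < T)%N.
  case: T def_t {zT Tmod Tp lt_Tr} => [|[|//]] def_t.
    by rewrite def_t eqxx in T_neq0.
  by rewrite def_t eqxx in T_neq1.
have r'T : ~~ (r %| T)%N by rewrite gtnNdvd // ltnW.
have [S [defS oS]] := cycle_GL.
have [//|//|D [defD oD]] := @diag_GL (\row_i z ^+ (T ^ i)%N) r.
- by move=> i; rewrite mxE exprAC (prim_expr_order prim_z) expr1n.
- exact: prime_gt0.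
have SD : (S * D = D ^+ T * S)%g.
  apply: val_inj; rewrite /= -[LHS]/(GLval S *m GLval D).
  rewrite -[RHS]/(GLval (D ^+ T)%g *m GLval S) GLval_exp defS defD cycle_mx_diag.
  congr (_ *m _); rewrite diag_mx_exp; congr diag_mx; apply/rowP=> i; rewrite !mxE -exprM /=.
  apply: zT; rewrite -expnSr; apply/Tmod.
  by rewrite expr_mod // -def_p prim_expr_order.
have nDS : S \in 'N(<[D]>)%g := norm_cycle SD.
have oDS : (#|(<[D]> <*> <[S]>)%g| %| r * p)%N.
  by apply: dvdn_trans (card_join_cycle_dvd nDS) _; rewrite dvdn_mul.
have rp_n : (r * p %| n)%N.
  rewrite Gauss_dvd ?rn /=; first by move: p_n; rewrite mem_primes => /and3P[].
  by rewrite prime_coprime // dvdn_prime2 // gtn_eqF.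
have co_q : coprime q (r * p).
  by rewrite coprimeMr coprime_qp prime_coprime // dvdn_prime2 // gtn_eqF.
have [v nzv eigv] := GL_eigenvector rp_n co_q oDS.
have JD : D \in (<[D]> <*> <[S]>)%g by rewrite mem_gen // inE cycle_id.
have JS : S \in (<[D]> <*> <[S]>)%g by rewrite mem_gen // inE cycle_id orbT.
have [e vD] := eigv D JD; have [s vS] := eigv S JS.
have nze := eigenvalue_neq0 nzv vD; have nzs := eigenvalue_neq0 nzv vS.
have eT : e ^+ T.-1 = 1.
  have : v *m GLval (S * D)%g = v *m GLval (D ^+ T * S)%g by rewrite SD.
  rewrite -[GLval (S * D)]/(GLval S *m GLval D) -[GLval (_ * S)]/(GLval (D ^+ T)%g *m GLval S).
  rewrite !mulmxA vS -scalemxAl vD scalerA GLval_exp (eigenvector_exp T vD).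
  rewrite -scalemxAl vS scalerA => /eqP.
  rewrite -subr_eq0 -scalerBl scaler_eq0 (negPf nzv) orbF subr_eq0 mulrC.
  have eS : e ^+ T = e * e ^+ T.-1 by rewrite -exprS prednK // ltnW.
  rewrite (inj_eq (mulIf nzs)) eS.
  by rewrite -{1}[e]mulr1 (inj_eq (mulfI nze)) eq_sym => /eqP.
have er : e ^+ r = 1.
  have Dr := order_dvd_expg1 oD.
  have := eigenvector_exp r vD; rewrite -GLval_exp Dr mulmx1 -[X in X = _]scale1r => /eqP.
  by rewrite -subr_eq0 -scalerBl scaler_eq0 (negPf nzv) orbF subr_eq0 eq_sym => /eqP.
(* $e^r = e^{T-1} = 1$, where $0 < T - 1 < r$. But no diagonal entry $z^{T^i}$ of [D] is 1, since $r
   \nmid T$. *)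
have e1 : e = 1.
  apply: expf_coprime_eq1 er eT; first exact: prime_gt0.
  rewrite prime_coprime // gtnNdvd ?(leq_ltn_trans (leq_pred T)) //.
  by rewrite -subn1 subn_gt0.
case/rV0Pn: nzv => i /negP[]; apply/eqP.
have /rowP/(_ i) := vD; rewrite e1 scale1r defD mul_mx_diag !mxE => /eqP.
rewrite -subr_eq0 -{2}[v 0 i]mulr1 -mulrBr mulf_eq0 subr_eq0 => /orP[/eqP // |].
by rewrite -(prim_order_dvd prim_z) Euclid_dvdX // (negPf r'T).
Qed.

End SmallPrime.

(** By Fermat $p \mid q^{p-1} - 1$, and $p - 1$ is at most the exponent of $q$ in $n$; so (1),
    already established, gives the divisibility $p \mid q - 1$ on which (b) relies. *)
Lemma supersolvable_number_small_prime_condition (n : nat) :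
  (0 < n)%N -> supersolvable_number n -> small_prime_condition n.
Proof.
move=> n_gt0 ssn p q p_n q_n neq_pq le_p.
have p_pr : prime p by move: p_n; rewrite mem_primes => /and3P[].
have q_pr : prime q by move: q_n; rewrite mem_primes => /and3P[].
have p_q : (p %| q.-1)%N.
  rewrite -subn1; apply: (supersolvable_number_order_condition n_gt0 ssn q_n p_n) (Fermat_pred p_pr q_pr neq_pq).
  by rewrite -subn1 subn_gt0 prime_gt1 // (leq_trans (leq_subr _ _)).
have def_p : p = p.-1.+1 by rewrite prednK ?prime_gt0.
split.
  case=> r r_n /andP[p_r r_q].
  exact: (no_intermediate_prime n_gt0 ssn p_pr q_pr def_p p_n neq_pq le_p r_n p_r r_q).
split; first exact: (logn_le2 n_gt0 ssn p_pr q_pr def_p).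
rewrite subn1; exact: (square_dvd_pred n_gt0 ssn p_pr q_pr def_p).
Qed.

End Necessity.

(** * From $\psi$ to multiplicative orders, and the equivalence *)

Lemma psi_prime_power (p a : nat) :
  prime p -> 0 < a -> psi (p ^ a) = psi_pp p a.
Proof.
by move=> p_pr a_gt0; rewrite /psi primesX // primes_prime // big_seq1 pfactorK.
Qed.

Lemma prime_dvd_psi_pp (p q a : nat) : prime q ->
  reflect (exists2 j, 0 < j <= a & q %| p ^ j - 1) (q %| psi_pp p a).
Proof.
move=> q_pr; rewrite /psi_pp Euclid_dvd_prod // big_has.
apply: (iffP hasP) => -[j].
  by rewrite mem_index_iota ltnS => ja q_j; exists j.
by move=> ja q_j; exists j; rewrite // mem_index_iota ltnS.
Qed.

(** The content of (1) is one inclusion of prime sets; the factor $j = 1$ of $\psi$ gives the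
    other. *)
Lemma multiplicative_order_conditionP (n : nat) : 0 < n ->
  (forall p, p \in primes n ->
     primes (gcdn n (psi (p ^ logn p n))) =i primes (gcdn n (p - 1))) <->
  multiplicative_order_condition n.
Proof.
move=> n_gt0; have in_gcd m q : (q \in primes (gcdn n m)) = [&& prime q, q %| n & q %| m].
  by rewrite mem_primes gcdn_gt0 n_gt0 dvdn_gcd.
have psi_n p : p \in primes n -> prime p /\ psi (p ^ logn p n) = psi_pp p (logn p n).
  move=> p_n; have := p_n; rewrite mem_primes => /and3P[p_pr _ _].
  by rewrite psi_prime_power // logn_gt0.
split=> [eq_primes p q j p_n q_n ja q_j | mocn p p_n q].
  have [_ def_psi] := psi_n p p_n.
  have := q_n; rewrite mem_primes => /and3P[q_pr _ qn].
  have := eq_primes p p_n q; rewrite !in_gcd q_pr qn def_psi /= => <-.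
  by apply/prime_dvd_psi_pp => //; exists j.
have [p_pr ->] := psi_n p p_n; rewrite !in_gcd.
case q_pr: (prime q) => //=; case qn: (q %| n) => //=.
have q_n : q \in primes n by rewrite mem_primes q_pr n_gt0.
apply/prime_dvd_psi_pp/idP => // [[j] | q_p]; first exact: mocn.
by exists 1; rewrite ?expn1 //= logn_gt0.
Qed.

Theorem mainTheorem7 (n : nat) (n_pos : (0 < n)%N) :
  (forall (gT : finGroupType) (G : {group gT}), #|G| = n -> supersolvable G)
  <->
  ((forall p, p \in primes n ->
      primes (gcdn n (psi (p ^ logn p n))) =i primes (gcdn n (p - 1)))
   /\
   (forall p q, p \in primes n -> q \in primes n -> p != q ->
      (p <= logn q n)%N ->
      (~ exists2 r, r \in primes n & (p %| r - 1) && (r %| q - 1))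
      /\ (logn p n <= 2)%N
      /\ (logn p n = 2 -> p ^ 2 %| q - 1))).
Proof.
split=> [ssn | [/(multiplicative_order_conditionP n_pos) mocn spcn] gT G oG].
  split; last exact: supersolvable_number_small_prime_condition.
  exact/(multiplicative_order_conditionP n_pos)/supersolvable_number_order_condition.
by apply: (conditions_supersolvable n_pos mocn spcn); rewrite oG.
Qed.
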